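(* Let $J\in C^2(\mathbb R)$ satisfy $J''<0$ and $J(0)=J(1)=0$, and let $m\in(0,1)$ be the unique maximum point of $J$. Let $\rho_-,\rho_+\in C^1(\mathbb R_+)$ take values in $[0,1]$. Suppose that $(\rho_-(t),\rho_+(t))\notin\Theta$ for almost every $t\ge0$, where $\Theta=\{(z,z^* )\in[0,1]^2:\ z<m\}$. Then the quasi-static conservation law $$\partial_xJ(u)=0,\qquad u(t,0)=\rho_-(t),\quad u(t,1)=\rho_+(t)$$ has a unique entropy solution $u$ (up to null sets), given by $$u(t,x)=\begin{cases}\rho_-(t),&\text{if }\rho_-(t)<m,\ \rho_+(t)<\rho_-^*(t),\\ \rho_+(t),&\text{if }\rho_+(t)>m,\ \rho_-(t)>\rho_+^*(t),\\ m,&\text{if }\rho_-(t)\ge m,\ \rho_+(t)\le m.\end{cases}$$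
   Context: Notation: $\mathbb R_+=[0,\infty)$; $C_0$ and $C_0^\infty$ denote continuous, respectively smooth, compactly supported functions. For $u\in[0,1]\setminus\{m\}$, $u^*$ is the unique element of $[0,1]\setminus\{m\}$ with $u^*\ne u$ and $J(u^* )=J(u)$; $m^*=m$. Write $\rho_\pm^*(t)=(\rho_\pm(t))^*$. A Lax entropy--entropy flux pair is a pair $(S,Q)$ with $S,Q\in C^2(\mathbb R)$, $S''\ge0$, $Q'=J'S'$. A boundary entropy--entropy flux pair is a pair $S,Q\in C^2(\mathbb R^2)$ such that for each $w\in\mathbb R$, $(S(\cdot,w),Q(\cdot,w))$ is a Lax entropy--entropy flux pair, and $S(w,w)=Q(w,w)=\partial_vS(v,w)|_{v=w}=0$; then $Q$ is called a boundary entropy flux. Entropy solution of the quasi-static law: a function $u\in L^\infty([0,\infty)\times[0,1])$ such that: (i) $\int_0^\infty\int_0^1J(u)\partial_x\varphi\,dx\,dt=0$ for all $\varphi\in C_0^\infty((0,\infty)\times(0,1))$; (ii) for every Lax pair $(S,Q)$ and every $\varphi\in C_0^\infty((0,\infty)\times(0,1))$ with $\varphi\ge0$, $\int_0^\infty\int_0^1Q(u)\partial_x\varphi\,dx\,dt\ge0$; (iii) for every boundary entropy flux $Q$ and every $\beta\in C_0(\mathbb R)$ with $\beta\ge0$, $\operatorname{ess\,lim}_{r\to0+}\int_0^\infty Q(u(t,r),\rho_-(t))\beta(t)\,dt\le0$ and $\operatorname{ess\,lim}_{r\to0+}\int_0^\infty Q(u(t,1-r),\rho_+(t))\beta(t)\,dt\ge0$.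 *)

(* Defs.v *)
From HB Require Import structures.
From mathcomp Require Import all_boot all_order all_algebra.
From mathcomp Require Import all_classical all_reals all_analysis.

Set Implicit Arguments.
Unset Strict Implicit.
Unset Printing Implicit Defensive.

Import Order.TTheory GRing.Theory Num.Theory.
Import numFieldNormedType.Exports.

Local Open Scope classical_set_scope.
Local Open Scope ring_scope.

Section defs.
Context {R : realType}.
Implicit Types (J S Q rho : R -> R) (f phi u : R * R -> R).

Definition C2 (f : R -> R) :=
  [/\ forall x, derivable f x 1, forall x, derivable (derive1 f) x 1
    & continuous (derive1 (derive1 f))].

(* The limit is taken along s >= 0, s <> t, hence is one-sided at t = 0; the
   values of rho on the negative reals are irrelevant. *)
Definition C1_Rplus rho :=
  exists2 d : R -> R, {within `[0, +oo[, continuous d} &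
    forall t, 0 <= t ->
      (rho s - rho t) / (s - t) @[s --> within `[0, +oo[ t^'] --> d t.

Definition partial1 f : R * R -> R := 'D_((1, 0) : R * R) f.
Definition partial2 f : R * R -> R := 'D_((0, 1) : R * R) f.

Fixpoint C_plane (k : nat) f : Prop :=
  continuous f /\
  if k is k'.+1 then
    [/\ forall p, derivable f p ((1, 0) : R * R),
        forall p, derivable f p ((0, 1) : R * R),
        C_plane k' (partial1 f) & C_plane k' (partial2 f)]
  else True.

Definition supp {T : topologicalType} (f : T -> R) : set T :=
  closure [set x | f x != 0].

Definition C0 (b : R -> R) := continuous b /\ compact (supp b).

(* Elements of C_0^oo(`]0, +oo[ x `]0, 1[), extended by zero to the plane. *)
Definition test_function phi :=
  [/\ forall k, C_plane k phi, compact (supp phi)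
    & supp phi `<=` `]0, +oo[ `*` `]0, 1[].

Definition unique_max_point J (m : R) := forall v, v != m -> J v < J m.

(* xget picks an element of the set, here a singleton for 0 <= u <= 1, u <> m;
   its first argument is the value returned on the empty set. *)
Definition star J (m u : R) : R :=
  if u == m then m
  else xget m [set v | [/\ v \in `[0, 1], v != u & J v = J u]].

Definition Theta J (m : R) : set (R * R) :=
  [set p | [/\ p.1 \in `[0, 1], p.2 \in `[0, 1], p.1 < m
             & p.2 = star J m p.1]].

Definition lax_pair J S Q :=
  [/\ C2 S, C2 Q, forall v, 0 <= derive1 (derive1 S) v
    & forall v, derive1 Q v = derive1 J v * derive1 S v].

Definition boundary_pair J (S Q : R * R -> R) :=
  [/\ C_plane 2 S, C_plane 2 Q,
      forall w, lax_pair J (fun v => S (v, w)) (fun v => Q (v, w))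
    & forall w,
        [/\ S (w, w) = 0, Q (w, w) = 0 & derive1 (fun v => S (v, w)) w = 0]].

Definition boundary_flux J (Q : R * R -> R) :=
  exists S : R * R -> R, boundary_pair J S Q.

(* Points of the plane are pairs (t, x). *)

Definition mu2 := (@lebesgue_measure R \x @lebesgue_measure R)%E.

Definition dom : set (R * R) := `[0, +oo[ `*` `[0, 1].

Definition Loo_dom u :=
  measurable_fun dom u /\
  exists M : R, {ae mu2, forall p, dom p -> `|u p| <= M}.

(* The essential limit of g(r) as r decreases to 0 exists and equals l. *)
Definition esslim0 (g : R -> R) (l : R) :=
  forall e, 0 < e -> exists2 d, 0 < d &
    {ae lebesgue_measure, forall r, 0 < r < d -> `|g r - l| < e}.

Definition entropy_solution J (rhom rhop : R -> R) u :=
  [/\ Loo_dom u,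
      forall phi, test_function phi ->
        \int[lebesgue_measure]_(t in `[0, +oo[)
          \int[lebesgue_measure]_(x in `[0, 1])
            (J (u (t, x)) * partial2 phi (t, x)) = 0,
      forall S Q phi, lax_pair J S Q -> test_function phi ->
        (forall p, 0 <= phi p) ->
        0 <= \int[lebesgue_measure]_(t in `[0, +oo[)
               \int[lebesgue_measure]_(x in `[0, 1])
                 (Q (u (t, x)) * partial2 phi (t, x))
    & forall (Q : R * R -> R) (b : R -> R), boundary_flux J Q -> C0 b ->
        (forall t, 0 <= b t) ->
        (exists2 l, l <= 0 & esslim0 (fun r =>
           \int[lebesgue_measure]_(t in `[0, +oo[)
             (Q (u (t, r), rhom t) * b t)) l) /\
        (exists2 l, 0 <= l & esslim0 (fun r =>
           \int[lebesgue_measure]_(t in `[0, +oo[)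
             (Q (u (t, 1 - r), rhop t) * b t)) l)].

(* z is the value prescribed by the three-case formula for boundary data a on
   the left and b on the right; the disjunction says that some case applies. *)
Definition quasistatic_value J (m a b z : R) :=
  let case1 := a < m /\ b < star J m a in
  let case2 := m < b /\ star J m b < a in
  let case3 := m <= a /\ b <= m in
  [/\ [\/ case1, case2 | case3],
      case1 -> z = a, case2 -> z = b & case3 -> z = m].

End defs.

(* Main.v *)
Require Import Defs.
From HB Require Import structures.
From mathcomp Require Import all_boot all_order all_algebra.
From mathcomp Require Import all_classical all_reals all_analysis.
From mathcomp Require Import measurable_realfun.
From mathcomp Require Import ring lra.

Set Implicit Arguments.
Unset Strict Implicit.
Unset Printing Implicit Defensive.

Import Order.TTheory GRing.Theory Num.Theory.
Import numFieldNormedType.Exports.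

Local Open Scope classical_set_scope.
Local Open Scope ring_scope.

(* With a = min(rho_-, m) and b = max(rho_+, m), the solution is b where
   J b < J a and a elsewhere; it does not depend on x, so only the boundary
   inequalities are at stake in the existence part, and they hold pointwise
   because Q(., w) - S'(m) J is nonincreasing.

   Uniqueness uses neither traces nor the equation itself.  Take boundary fluxes
   Q(v, w) = q(v) chi(w), with q the flux of a half entropy with threshold k.
   By the entropy inequality, x |-> q(u(t, x)) is nonincreasing in the sense of
   distributions, so its sign is controlled by the essential limits at x = 0 and
   x = 1: testing with alpha(t) psi(x), where psi' is a bump minus its rescaled
   copy concentrated at the boundary, and with beta = alpha / chi(rho) in the
   boundary condition, gives q(u) <= 0 where chi(rho_-) > 0 and q(u) >= 0 where
   chi(rho_+) > 0, almost everywhere.  Letting k range over the rationals yields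
   a <= u <= b and J u <= min(J a, J b), and strict concavity of J leaves only
   the announced value, except on Theta. *)

(** An essentially bounded [u] need not have boundary traces, and the boundary conditions concern
    one weight [beta] at a time, each with its own null set. This is why the tests form a countable
    family of smooth bumps with rational endpoints. The product form [q(v) chi(w)] copes with data
    that move in time: [chi (rho t)] depends on [t] alone and is divided out by the weight, leaving
    a fixed function [q] to compare between the interior and the boundary. The price is paid on the
    diagonal: [chi] has to vanish when [w] lies on the side of [k] that carries the entropy. Since
    entropies are C^2, the kink is spread between two thresholds [k] and [k'], whose order decides
    on which side of [k] the entropy lives. Beyond [k'] its slope is constant, so there [q] is a
    multiple of [J] plus a constant, and the sign of [q] becomes a comparison of [J u] with [J k'].
    Thresholds tending to the boundary datum bound [J u]; the others locate [u] itself. *)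

Section calculus.
Context {R : realType}.
Implicit Types f g : R -> R.

Lemma is_derive_continuous f (x d : R) :
  is_derive x 1 f d -> {for x, continuous f}.
Proof.
by move=> [df _]; apply/differentiable_continuous/derivable1_diffP.
Qed.

Lemma is_derive_ext f g (x d d' : R) :
  f =1 g -> d = d' -> is_derive x 1 f d -> is_derive x 1 g d'.
Proof. by move=> /funext -> ->. Qed.

Lemma is_derive_derive1 f (x d : R) : is_derive x 1 f d -> derive1 f x = d.
Proof. by move=> fx; rewrite derive1E derive_val. Qed.

Lemma derivable_is_derive f (x : R) :
  derivable f x 1 -> is_derive x 1 f (derive1 f x).
Proof. by move=> fx; rewrite derive1E; apply: derivableP. Qed.

Lemma is_derive_affine f (a b x d : R) :
  is_derive (a * x + b) 1 f d ->
  is_derive x 1 (fun y => f (a * y + b)) (a * d).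
Proof.
move=> fd.
have h : is_derive x 1 (fun y : R => a * y + b) a.
  apply: (@is_derive_ext (a \*: id + cst b)) => //.
  by rewrite addr0 /GRing.scale /= mulr1.
have := is_derive1_comp (f := f) (g := fun y : R => a * y + b).
by rewrite mulrC; apply.
Qed.

Section monotone.
Variables f g : R -> R.
Hypothesis fg : forall x : R, is_derive x 1 f (g x).

Let mvt (a b : R) : a < b ->
  exists2 c, c \in `]a, b[ & f b - f a = g c * (b - a).
Proof.
move=> ab; apply: MVT => //.
by apply: continuous_subspaceT => x; apply: is_derive_continuous (fg x).
Qed.

Lemma is_derive_ge0_le (a b : R) : a <= b ->
  (forall x, a < x < b -> 0 <= g x) -> f a <= f b.
Proof.
rewrite le_eqVlt => /predU1P[->//|ab] g0.
have [c /[!in_itv]/= acb e] := mvt ab.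
by rewrite -subr_ge0 e mulr_ge0 ?g0// subr_ge0 ltW.
Qed.

Lemma is_derive_gt0_lt (a b : R) : a < b ->
  (forall x, a < x < b -> 0 < g x) -> f a < f b.
Proof.
move=> ab g0; have [c /[!in_itv]/= acb e] := mvt ab.
by rewrite -subr_gt0 e mulr_gt0 ?g0// subr_gt0.
Qed.

Lemma is_derive_eq0_eq (a b : R) : a <= b ->
  (forall x, a < x < b -> g x = 0) -> f a = f b.
Proof.
rewrite le_eqVlt => /predU1P[->//|ab] g0.
have [c /[!in_itv]/= acb e] := mvt ab.
by apply/esym/eqP; rewrite -subr_eq0 e g0// mul0r.
Qed.

End monotone.

(** The derivative is an existential witness, so closure under sums, products and affine changes of
    variable is proved by exhibiting it, without computing [derive1]. *)
Fixpoint Cn (k : nat) f : Prop :=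
  if k is k'.+1 then
    exists2 g : R -> R, (forall x : R, is_derive x 1 f (g x)) & Cn k' g
  else continuous f.

Lemma Cn_continuous k f : Cn k f -> continuous f.
Proof.
by case: k => [//|k] [g fg _] x; apply: is_derive_continuous (fg x).
Qed.

Lemma Cn_S k f : Cn k.+1 f -> Cn k f.
Proof.
elim: k f => [|k IH] f.
  by move=> fC; apply: (@Cn_continuous 1).
by case=> g fg gC; exists g => //; apply: IH.
Qed.

Lemma Cn_le k n f : (k <= n)%N -> Cn n f -> Cn k f.
Proof.
move=> /subnK <-; elim: (n - k)%N => [//|j IH]; rewrite addSn => /Cn_S; exact: IH.
Qed.

Lemma Cn_cst k (c : R) : Cn k (fun=> c).
Proof.
elim: k c => [|k IH] c /=; first exact: cst_continuous.
by exists (fun=> 0) => // x; apply: is_derive_cst.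
Qed.

Lemma CnD k f g : Cn k f -> Cn k g -> Cn k (fun x => f x + g x).
Proof.
elim: k f g => [|k IH] f g /=.
  by move=> fC gC x; apply: continuousD; [apply: fC|apply: gC].
move=> [f' ff' f'C] [g' gg' g'C]; exists (fun x => f' x + g' x); last exact: IH.
by move=> x; apply: is_deriveD.
Qed.

Lemma CnM k f g : Cn k f -> Cn k g -> Cn k (fun x => f x * g x).
Proof.
elim: k f g => [|k IH] f g.
  by move=> fC gC x; apply: continuousM; [apply: fC|apply: gC].
move=> fC gC.
have [f' ff' f'C] := fC; have [g' gg' g'C] := gC.
exists (fun x => f x * g' x + g x * f' x).
  by move=> x; apply: is_deriveM.
by apply: CnD; apply: IH => //; exact: Cn_S.
Qed.

Lemma Cn_affine k f (a b : R) : Cn k f -> Cn k (fun x => f (a * x + b)).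
Proof.
elim: k f => [|k IH] f /=.
  move=> fC x; apply: (@continuous_comp _ _ _ (fun x => a * x + b) f).
    by apply: cvgD; [apply: cvgM; [exact: cvg_cst|exact: cvg_id]|exact: cvg_cst].
  exact: fC.
move=> [g fg gC]; exists (fun x => a * g (a * x + b)).
  by move=> x; apply: is_derive_affine.
by apply: CnM; [exact: Cn_cst|exact: IH].
Qed.

Lemma C2_Cn f : C2 f -> Cn 2 f.
Proof.
move=> [f1 f2 f3]; exists (derive1 f).
  by move=> x; apply: derivable_is_derive.
exists (derive1 (derive1 f)); last exact: f3.
by move=> x; apply: derivable_is_derive.
Qed.

Lemma Cn_C2 f : Cn 2 f -> C2 f.
Proof.
move=> [f' ff' [f'' f'f'' f''C]].
have e1 : derive1 f = f' by apply/funext => x; apply: is_derive_derive1.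
have e2 : derive1 f' = f'' by apply/funext => x; apply: is_derive_derive1.
split; [|rewrite e1|by rewrite e1 e2].
- by move=> x; case: (ff' x).
- by move=> x; case: (f'f'' x).
Qed.

Lemma is_derive_slice1 (F : R * R -> R) (p : R * R) (d : R) :
  is_derive p.1 1 (fun y => F (y, p.2)) d ->
  derivable F p (1, 0) /\ 'D_(1, 0) F p = d.
Proof.
case=> Fd <-; rewrite /derivable /derive.
suff -> : (fun h : R => h^-1 *: (F (h *: (1, 0) + p) - F p)) =
  (fun h : R => h^-1 *: (F (h *: 1 + p.1, p.2) - F (p.1, p.2))) by [].
case: p {Fd} => a b /=; apply/funext => h; congr (_ *: (F _ - F _)).
by congr pair; rewrite /= scaler0 add0r.
Qed.

Lemma is_derive_slice2 (F : R * R -> R) (p : R * R) (d : R) :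
  is_derive p.2 1 (fun y => F (p.1, y)) d ->
  derivable F p (0, 1) /\ 'D_(0, 1) F p = d.
Proof.
case=> Fd <-; rewrite /derivable /derive.
suff -> : (fun h : R => h^-1 *: (F (h *: (0, 1) + p) - F p)) =
  (fun h : R => h^-1 *: (F (p.1, h *: 1 + p.2) - F (p.1, p.2))) by [].
case: p {Fd} => a b /=; apply/funext => h; congr (_ *: (F _ - F _)).
by congr pair; rewrite /= scaler0 add0r.
Qed.

Lemma is_derive_of_slice2 (F : R * R -> R) (p : R * R) :
  derivable F p (0, 1) ->
  is_derive p.2 1 (fun y => F (p.1, y)) ('D_(0, 1) F p).
Proof.
have e : (fun h : R => h^-1 *: (F (h *: (0, 1) + p) - F p)) =
  (fun h : R => h^-1 *: (F (p.1, h *: 1 + p.2) - F (p.1, p.2))).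
  case: p => a b /=; apply/funext => h; congr (_ *: (F _ - F _)).
  by congr pair; rewrite /= scaler0 add0r.
by move=> Fd; split; move: Fd; rewrite /derivable /derive e.
Qed.

Lemma C_plane_continuous k (F : R * R -> R) : C_plane k F -> continuous F.
Proof. by case: k => [|k] []. Qed.

(** Both partial derivatives of a function with separated variables again have separated variables,
    so the induction closes. *)
Lemma C_plane_prod k f g : Cn k f -> Cn k g ->
  C_plane k (fun p => f p.1 * g p.2).
Proof.
elim: k f g => [|k IH] f g fC gC.
  split=> //= p; apply: cvgM.
    by apply: (@continuous_comp _ _ _ fst f); [exact: cvg_fst|exact: fC].
  by apply: (@continuous_comp _ _ _ snd g); [exact: cvg_snd|exact: gC].
have [f' ff' f'C] := fC; have [g' gg' g'C] := gC.
have D1 (p : R * R) : derivable (fun p : R * R => f p.1 * g p.2) p ((1, 0) : R * R) /\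
    partial1 (fun p => f p.1 * g p.2) p = f' p.1 * g p.2.
  apply: is_derive_slice1 => /=.
  apply: (@is_derive_ext (g p.2 \*: f) _ _ (g p.2 *: f' p.1)).
    by move=> y; rewrite mulrC.
  exact: mulrC.
have D2 (p : R * R) : derivable (fun p : R * R => f p.1 * g p.2) p ((0, 1) : R * R) /\
    partial2 (fun p => f p.1 * g p.2) p = f p.1 * g' p.2.
  by apply: is_derive_slice2 => /=; exact: is_deriveZ.
split; first exact: C_plane_continuous (IH _ _ (Cn_S fC) (Cn_S gC)).
split=> [p|p||]; [exact: (D1 p).1|exact: (D2 p).1| |].
- have -> : partial1 (fun p => f p.1 * g p.2) = (fun p => f' p.1 * g p.2).
    by apply/funext => p; exact: (D1 p).2.
  by apply: IH => //; exact: Cn_S.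
- have -> : partial2 (fun p => f p.1 * g p.2) = (fun p => f p.1 * g' p.2).
    by apply/funext => p; exact: (D2 p).2.
  by apply: IH => //; exact: Cn_S.
Qed.

End calculus.

(** * Smooth bumps and their primitives *)

Section bump.
Context {R : realType}.
Implicit Types f g : R -> R.

(** For [n > 0], raise [y / n <= expR (y / n)] to the power [n]. *)
Lemma exprn_le_expR (n : nat) (y : R) : 0 <= y ->
  y ^+ n <= n%:R ^+ n * expR y.
Proof.
case: n => [|n] y0; first by rewrite !expr0 mul1r (le_trans _ (expR_ge1Dx _)) ?lerDl.
have n0 : 0 < n.+1%:R :> R by rewrite ltr0n.
have yn0 : 0 <= y / n.+1%:R by exact: divr_ge0 y0 (ltW n0).
have h : (y / n.+1%:R) ^+ n.+1 <= expR (y / n.+1%:R) ^+ n.+1.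
  apply: lerXn2r; rewrite ?nnegrE ?expR_ge0//.
  by rewrite (le_trans _ (expR_ge1Dx _))// lerDr.
move: h; rewrite -expRM_natl [n.+1%:R * _]mulrC divfK ?gt_eqF// expr_div_n.
by rewrite ler_pdivrMr ?exprn_gt0// mulrC.
Qed.

(* The functions [x^-n exp(-1/x)], extended by 0 to [x <= 0], are closed under
   differentiation up to linear combinations, hence smooth. *)
Definition invexp (n : nat) (x : R) : R :=
  if 0 < x then x^-1 ^+ n * expR (- x^-1) else 0.

Lemma invexp_le0 n (x : R) : x <= 0 -> invexp n x = 0.
Proof. by rewrite /invexp ltNge => ->. Qed.

Lemma invexp_gt0 n (x : R) : 0 < x -> 0 < invexp n x.
Proof.
by move=> x0; rewrite /invexp x0 mulr_gt0 ?expR_gt0// exprn_gt0// invr_gt0.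
Qed.

Lemma invexp_ge0 n (x : R) : 0 <= invexp n x.
Proof.
have [x0|x0] := ltP 0 x; first exact/ltW/invexp_gt0.
by rewrite invexp_le0.
Qed.

Lemma invexp0_le1 (x : R) : invexp 0 x <= 1.
Proof.
rewrite /invexp; case: ifPn => // x0.
by rewrite expr0 mul1r -expR0 ler_expR oppr_le0 invr_ge0 ltW.
Qed.

(** A quadratic bound makes the difference quotient at 0 tend to 0. It is [exprn_le_expR] at [x^-1]
    with exponent [n + 2], the two extra powers giving [x ^+ 2]. *)
Lemma invexp_bound n : exists2 K : R, 0 <= K &
  forall x, `|invexp n x| <= K * x ^+ 2.
Proof.
exists (n.+2%:R ^+ n.+2); first exact: exprn_ge0.
move=> x; rewrite ger0_norm ?invexp_ge0//.
rewrite /invexp; case: ifPn => [x0|_]; last by apply: mulr_ge0; [exact: exprn_ge0|exact: sqr_ge0].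
have := @exprn_le_expR n.+2 x^-1; rewrite invr_ge0 (ltW x0) => /(_ isT) h.
rewrite expRN ler_pdivrMr ?expR_gt0// mulrAC -ler_pdivrMr ?exprn_gt0//.
by rewrite -exprVn -exprD addn2.
Qed.

Lemma is_derive_invexp n (x : R) :
  is_derive x 1 (invexp n) (invexp n.+2 x - n%:R * invexp n.+1 x).
Proof.
have [x0|x0|->] := ltgtP x 0.
- rewrite !invexp_le0 ?ltW// mulr0 subr0.
  apply: (@near_eq_is_derive _ _ _ (cst 0)).
  near=> y; rewrite invexp_le0//; apply: ltW.
  by near: y; exact: lt_nbhsl.
- rewrite {2 3}/invexp x0.
  have xV : is_derive x 1 (fun y : R => y^-1) (- x ^- 2).
    apply: (@is_derive_ext _ (fun y : R => (id y)^-1) _ _ (- x ^- 2 *: 1)) => //.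
      by rewrite /GRing.scale /= mulr1.
    by apply: is_deriveV; rewrite ?gt_eqF.
  have xE : is_derive x 1 (fun y : R => expR (- y^-1)) (expR (- x^-1) * x ^- 2).
    apply: (@is_derive_ext _ (expR \o (fun y => - y^-1)) _ _ (expR (- x^-1) * - - x ^- 2)) => //.
    by rewrite opprK.
  have xP : is_derive x 1 (fun y : R => y^-1 ^+ n) (n%:R * x^-1 ^+ n.-1 * - x ^- 2).
    apply: (@is_derive_ext _ ((fun y : R => y^-1) ^+ n) _ _
      ((n%:R * x^-1 ^+ n.-1) *: (- x ^- 2))) => //.
    by move=> y; rewrite exprfctE.
  pose h (y : R) := y^-1 ^+ n * expR (- y^-1).
  suff hx : is_derive x 1 h (x^-1 ^+ n.+2 * expR (- x^-1) -
      n%:R * (x^-1 ^+ n.+1 * expR (- x^-1))).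
    apply: near_eq_is_derive hx.
    near=> y; rewrite /invexp; case: ifPn => // /negP; apply: contra_notP => _.
    by near: y; exact: lt_nbhsr.
  apply: (@is_derive_ext _ ((fun y : R => y^-1 ^+ n) * (fun y => expR (- y^-1)))
    _ _ (x^-1 ^+ n * (expR (- x^-1) * x ^- 2) +
         expR (- x^-1) * (n%:R * x^-1 ^+ n.-1 * - x ^- 2))).
  + by [].
  + rewrite -!exprVn; case: (n) => [|m] /=.
      by rewrite !mul0r mulr0 addr0 subr0 expr0 mul1r mulrC.
    rewrite !exprS; ring.
  + exact: is_deriveM.
- rewrite !invexp_le0// mulr0 subr0.
  have [K K0 hK] := invexp_bound n.
  (* This slope function takes the value 0 at 0, so what remains is its continuity there, supplied
     by the quadratic bound. *)
  apply/is_derive1_caratheodory; exists (fun z => invexp n z / z).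
  rewrite invexp_le0// mul0r; split=> // [z|].
    have [->|z0] := eqVneq z 0; first by rewrite invexp_le0// !subrr mulr0.
    by rewrite !subr0 divfK.
  rewrite /prop_for /continuous_at invr0 mulr0; apply/cvgrPdist_le => /= e e0.
  have K1 : 0 < K + 1 by rewrite ltr_wpDl.
  near=> z; rewrite sub0r normrN.
  have [->|z0] := eqVneq z 0; first by rewrite invr0 mulr0 normr0 ltW.
  rewrite normrM normfV ler_pdivrMr ?normr_gt0//.
  apply: (le_trans (hK z)).
  rewrite -(real_normK (num_real z)) expr2 mulrA.
  rewrite ler_pM2r ?normr_gt0//.
  apply: (@le_trans _ _ ((K + 1) * `|z|)).
    by rewrite ler_wpM2r// lerDl.
  rewrite mulrC -ler_pdivlMr//.
  near: z; rewrite -[X in \forall z \near X, _]/(nbhs (0 : R)).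
  exists (e / (K + 1)); rewrite /= ?divr_gt0// => z /=.
  by rewrite sub0r normrN => /ltW.
Unshelve. all: by end_near. Qed.

Lemma Cn_invexp k n : Cn k (invexp n).
Proof.
elim: k n => [|k IH] n.
  by move=> x; apply: is_derive_continuous (is_derive_invexp n x).
exists (fun x => invexp n.+2 x + (- n%:R) * invexp n.+1 x).
  by move=> x; rewrite mulNr; exact: is_derive_invexp.
by apply: CnD => //; apply: CnM => //; exact: Cn_cst.
Qed.

(** The parameter [r] is a sharpness: as it grows, the bump stays below 1 and tends to the indicator
    of []c, d[]. *)
Definition bump (c d r x : R) : R :=
  invexp 0 (r * (x - c)) * invexp 0 (r * (d - x)).

Lemma bump_ge0 c d r x : 0 <= bump c d r x.
Proof. by rewrite mulr_ge0 ?invexp_ge0. Qed.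

Lemma bump_le1 c d r x : bump c d r x <= 1.
Proof. by rewrite mulr_ile1 ?invexp_ge0 ?invexp0_le1. Qed.

Lemma bump_out c d r x : 0 <= r -> ~~ (c < x < d) -> bump c d r x = 0.
Proof.
move=> r0; rewrite negb_and -!leNgt /bump => /orP[h|h].
  by rewrite invexp_le0 ?mul0r// mulr_ge0_le0// subr_le0.
by rewrite [X in _ * X]invexp_le0 ?mulr0// mulr_ge0_le0// subr_le0.
Qed.

Lemma bump_gt0 c d r x : 0 < r -> c < x < d -> 0 < bump c d r x.
Proof.
by move=> r0 /andP[cx xd]; rewrite mulr_gt0// invexp_gt0// mulr_gt0// subr_gt0.
Qed.

Lemma Cn_bump k c d r : Cn k (bump c d r).
Proof.
apply: CnM.
  rewrite (_ : (fun x => _) = (fun x => invexp 0 (r * x + - (r * c)))).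
    exact/Cn_affine/Cn_invexp.
  by apply/funext => x; rewrite mulrBr.
rewrite (_ : (fun x => _) = (fun x => invexp 0 (- r * x + r * d))).
  exact/Cn_affine/Cn_invexp.
by apply/funext => x; rewrite mulrBr addrC mulNr.
Qed.

Lemma antiderivative f (c : R) : continuous f -> (forall x, x <= c -> f x = 0) ->
  exists2 F : R -> R, forall x : R, is_derive x 1 F (f x) &
    forall x, x <= c -> F x = 0.
Proof.
move=> fC f0.
(* Starting at [c - 1] instead of [c] makes every [x >= c] an interior point for the fundamental
   theorem of calculus; [f] vanishes on the added piece. *)
pose F x := \int[@lebesgue_measure R]_(t in `[c - 1, x]) f t.
have F0 x : x <= c -> F x = 0.
  move=> xc; rewrite /F (@eq_Rintegral _ _ _ _ _ (cst 0)) ?Rintegral_cst ?mul0r//.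
  by move=> y; rewrite inE/= in_itv/= => /andP[_ yx]; rewrite f0// (le_trans yx).
exists F => // x.
have [xc|cx] := ltP x c.
  rewrite f0 ?ltW//; apply: (@near_eq_is_derive _ _ _ (cst 0)).
  near=> y; rewrite F0//; apply: ltW.
  by near: y; exact: lt_nbhsl.
have [||||dF eF] := @continuous_FTC1_closed _ f (c - 1) x (x + 1).
- by rewrite ltrDl.
- apply: continuous_compact_integrable; first exact: segment_compact.
  exact: continuous_subspaceT.
- by rewrite (lt_le_trans _ cx)// ltrBlDr ltrDl.
- exact: fC.
- by rewrite -eF; exact: derivable_is_derive.
Unshelve. all: by end_near. Qed.

(** A smoothed Heaviside step. It serves as the profile of the derivative of the half entropies, and
    in differences that give test functions of constant sign. *)
Lemma bump_primitive (c d r : R) : c <= d -> 0 <= r -> exists Z : R -> R,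
  [/\ forall x : R, is_derive x 1 Z (bump c d r x),
      forall x, x <= c -> Z x = 0, {homo Z : x y / x <= y}
    & forall x y, d <= x -> d <= y -> Z x = Z y].
Proof.
move=> cd r0.
have [||Z dZ Z0] := @antiderivative (bump c d r) c.
- exact: (@Cn_bump 0).
- by move=> x xc; rewrite bump_out// negb_and -leNgt xc.
have hZ x y : x <= y -> Z x <= Z y.
  by move=> xy; apply: (is_derive_ge0_le dZ) => // z _; exact: bump_ge0.
exists Z; split=> // x y.
wlog xy : x y / x <= y.
  by move=> H; have [?|/ltW ? ? ?] := leP x y; [exact: H|apply/esym/H].
move=> dx dy; apply: (is_derive_eq0_eq dZ) => // z /andP[xz _].
by rewrite bump_out// negb_and -!leNgt (le_trans dx (ltW xz)) orbT.
Qed.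

End bump.

(** * Sign of the boundary fluxes at the quasi-static value *)

Section flux.
Context {R : realType}.
Variables (J : R -> R) (m : R).
Hypothesis J_C2 : C2 J.
Hypothesis J_concave : forall v, derive1 (derive1 J) v < 0.
Hypothesis m_max : unique_max_point J m.

Lemma flux_is_derive (v : R) : is_derive v 1 J (derive1 J v).
Proof. by apply: derivable_is_derive; case: J_C2. Qed.

Lemma flux_continuous : continuous J.
Proof. by move=> v; apply: is_derive_continuous (flux_is_derive v). Qed.

Lemma flux_derive_decr (x y : R) : x < y -> derive1 J y < derive1 J x.
Proof.
move=> xy; rewrite -ltrN2.
apply: (@is_derive_gt0_lt _ (fun v => - derive1 J v)
  (fun v => - derive1 (derive1 J) v)) => // [v|v _]; last by rewrite oppr_gt0.
by apply: is_deriveN; apply: derivable_is_derive; case: J_C2.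
Qed.

(** The mean value theorem on [[x, m]] gives a point of positive slope, and the slope at [x] is
    larger still because [J'] decreases. *)
Lemma flux_derive_gt0 (x : R) : x < m -> 0 < derive1 J x.
Proof.
move=> xm.
have [|c] := MVT xm (fun v _ => flux_is_derive v).
  exact: continuous_subspaceT flux_continuous.
rewrite in_itv/= => /andP[xc _] e.
apply: lt_trans (flux_derive_decr xc).
by rewrite -(pmulr_lgt0 _ (_ : 0 < m - x)) ?subr_gt0// -e subr_gt0 m_max ?lt_eqF.
Qed.

Lemma flux_derive_lt0 (x : R) : m < x -> derive1 J x < 0.
Proof.
move=> mx.
have [|c] := MVT mx (fun v _ => flux_is_derive v).
  exact: continuous_subspaceT flux_continuous.
rewrite in_itv/= => /andP[_ cx] e.
apply: lt_trans (flux_derive_decr cx) _.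
by rewrite -(pmulr_llt0 _ (_ : 0 < x - m)) ?subr_gt0// -e subr_lt0 m_max ?gt_eqF.
Qed.

Lemma flux_incr (x y : R) : x < y -> y <= m -> J x < J y.
Proof.
move=> xy ym; apply: (is_derive_gt0_lt flux_is_derive) => // z /andP[_ zy].
by apply: flux_derive_gt0; apply: lt_le_trans ym.
Qed.

Lemma flux_decr (x y : R) : m <= x -> x < y -> J y < J x.
Proof.
move=> mx xy; rewrite -ltrN2.
apply: (@is_derive_gt0_lt _ (fun v => - J v) (fun v => - derive1 J v)) => //.
  by move=> v; apply: is_deriveN; exact: flux_is_derive.
move=> z /andP[xz _].
by rewrite oppr_gt0; apply: flux_derive_lt0; apply: le_lt_trans xz.
Qed.

Lemma flux_le_max v : J v <= J m.
Proof. by have [->//|/m_max/ltW] := eqVneq v m. Qed.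

Section pair_sign.
Variables (S Q : R * R -> R) (w : R).
Hypothesis SQ : boundary_pair J S Q.

Let q v := Q (v, w).
Let s := derive1 (fun v => S (v, w)).

Let dq (v : R) : is_derive v 1 q (derive1 J v * s v).
Proof.
have [_ _ /(_ w)[_ [dQ _ _] _ e] _] := SQ.
by rewrite -e; apply: derivable_is_derive.
Qed.

Let ds (v : R) : is_derive v 1 s (derive1 s v).
Proof.
have [_ _ /(_ w)[[_ dS _] _ _ _] _] := SQ.
exact: derivable_is_derive.
Qed.

Let s_le (x y : R) : x <= y -> s x <= s y.
Proof.
move=> xy; apply: (is_derive_ge0_le ds) => // z _.
by have [_ _ /(_ w)[_ _ + _] _] := SQ; exact.
Qed.

Let sw : s w = 0. Proof. by have [_ _ _ /(_ w)[]] := SQ. Qed.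
Let qw : q w = 0. Proof. by have [_ _ _ /(_ w)[]] := SQ. Qed.

Let flux_derive_ge0 (x : R) : x < m -> 0 <= derive1 J x.
Proof. by move=> /flux_derive_gt0/ltW. Qed.

Let flux_derive_le0 (x : R) : m < x -> derive1 J x <= 0.
Proof. by move=> /flux_derive_lt0/ltW. Qed.

(* The derivative [J' (S' - S' m)] is nonpositive because both factors change
   sign at [m], in opposite directions. *)
Let q_sub_le (x y : R) : x <= y ->
  q y - s m * J y <= q x - s m * J x.
Proof.
move=> xy; rewrite -lerN2.
apply: (@is_derive_ge0_le _ (fun v => - (q v - s m * J v))
  (fun v => - (derive1 J v * s v - s m * derive1 J v))) => //.
  move=> v; apply: is_deriveN; apply: is_deriveB.
    exact: dq.
  exact: (@is_deriveZ _ _ _ J (s m) v 1 _ (flux_is_derive v)).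
move=> v _; rewrite [s m * _]mulrC -mulrBr oppr_ge0.
have [vm|mv|->] := ltgtP v m.
- by rewrite mulr_ge0_le0// ?subr_le0 ?s_le ?ltW// flux_derive_gt0.
- by rewrite mulr_le0_ge0// ?subr_ge0 ?s_le ?ltW// flux_derive_lt0.
- by rewrite subrr mulr0.
Qed.

(** To the right of [m] one has [J' <= 0], while [s] changes from nonpositive to nonnegative at [w];
    hence [q] has its maximum there at [w], where it vanishes. *)
Lemma boundary_flux_ge_max v : m <= v -> m <= w -> Q (v, w) <= 0.
Proof.
move=> mv mw; rewrite -/(q v) -qw; have [vw|/ltW wv] := leP v w.
  apply: (is_derive_ge0_le dq) => // z /andP[vz zw].
  by rewrite mulr_le0// ?flux_derive_le0 ?(le_lt_trans mv)// -sw s_le// ltW.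
rewrite -lerN2; apply: (@is_derive_ge0_le _ (fun v => - q v)
  (fun v => - (derive1 J v * s v))) => //.
  by move=> x; apply: is_deriveN.
move=> z /andP[wz zv].
rewrite oppr_ge0 mulr_le0_ge0// ?flux_derive_le0 ?(le_lt_trans mw)//.
by rewrite -sw s_le// ltW.
Qed.

(** Comparing [w] with [v] through [q_sub_le] gives [Q (v, w) <= s m * (J v - J w)], and
    [s m >= s w = 0]. *)
Lemma boundary_flux_across_left v : w <= m -> m <= v -> J v <= J w ->
  Q (v, w) <= 0.
Proof.
move=> wm mv Jvw; have := q_sub_le (le_trans wm mv).
rewrite -/(q v) qw sub0r => h.
have : s m * (J v - J w) <= 0.
  by rewrite mulr_ge0_le0// ?subr_le0// -sw s_le.
by rewrite mulrBr => h'; move: h h'; lra.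
Qed.

Lemma boundary_flux_le_max v : v <= m -> w <= m -> 0 <= Q (v, w).
Proof.
move=> vm wm; rewrite -/(q v) -qw; have [wv|/ltW vw] := leP w v.
  apply: (is_derive_ge0_le dq) => // z /andP[wz zv].
  by rewrite mulr_ge0// ?flux_derive_ge0 ?(lt_le_trans zv)// -sw s_le// ltW.
rewrite -lerN2; apply: (@is_derive_ge0_le _ (fun v => - q v)
  (fun v => - (derive1 J v * s v))) => //.
  by move=> x; apply: is_deriveN.
move=> z /andP[vz zw].
rewrite oppr_ge0 mulr_ge0_le0// ?flux_derive_ge0 ?(lt_le_trans zw)//.
by rewrite -sw s_le// ltW.
Qed.

Lemma boundary_flux_across_right v : v <= m -> m <= w -> J v <= J w ->
  0 <= Q (v, w).
Proof.
move=> vm mw Jvw; have := q_sub_le (le_trans vm mw).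
rewrite -/(q v) qw sub0r => h.
have : 0 <= s m * (J v - J w).
  by rewrite mulr_le0// ?subr_le0// -sw s_le.
by rewrite mulrBr => h'; move: h h'; lra.
Qed.

End pair_sign.

(** The value of [J] at this point is the Godunov flux of the pair [(a, b)], the minimum of the
    demand [J a'] and the supply [J b']. Truncating at [m] absorbs the third case of the formula,
    where both truncations equal [m]. A tie with [a'] and [b'] distinct forces [a < m < b] and
    [J a = J b]. *)
Definition quasistatic (a b : R) : R :=
  let a' := Num.min a m in let b' := Num.max b m in
  if J b' < J a' then b' else a'.

Lemma quasistatic_left S Q a b :
  boundary_pair J S Q -> Q (quasistatic a b, a) <= 0.
Proof.
move=> SQ; rewrite /quasistatic.
have [am|/ltW ma] := leP a m; case: ifPn => [Jba|_].
- by apply: (boundary_flux_across_left SQ); rewrite ?le_max ?lexx ?orbT// ltW.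
- by have [_ _ _ /(_ a)[_ -> _]] := SQ.
- by apply: (boundary_flux_ge_max SQ); rewrite ?le_max ?lexx ?orbT.
- exact: (boundary_flux_ge_max SQ).
Qed.

Lemma quasistatic_right S Q a b :
  boundary_pair J S Q -> 0 <= Q (quasistatic a b, b).
Proof.
move=> SQ; rewrite /quasistatic.
have [mb|/ltW bm] := leP m b; case: ifPn => [_|].
- by have [_ _ _ /(_ b)[_ -> _]] := SQ.
- rewrite -leNgt => Jab.
  by apply: (boundary_flux_across_right SQ); rewrite ?ge_min ?lexx ?orbT.
- exact: (boundary_flux_le_max SQ).
- by move=> _; apply: (boundary_flux_le_max SQ); rewrite ?ge_min ?lexx ?orbT.
Qed.

(** Strictly between [a'] and [b'], [J] exceeds [J a'] up to [m] and [J b'] from [m] on, so [z] must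
    be an endpoint. The bounds on [J z] select the endpoint with the smaller value, and a tie
    between distinct endpoints is what the excluded triple describes. *)
Lemma quasistatic_unique (a b z : R) :
  ~ [/\ a < m, m < b & J a = J b] ->
  Num.min a m <= z -> J z <= J (Num.min a m) ->
  z <= Num.max b m -> J z <= J (Num.max b m) -> z = quasistatic a b.
Proof.
move=> nab; rewrite /quasistatic.
set a' := Num.min a m; set b' := Num.max b m => az Jza zb Jzb.
have am : a' <= m by rewrite ge_min lexx orbT.
have mb : m <= b' by rewrite le_max lexx orbT.
have [e|e] : z = a' \/ z = b'.
- have [->|za] := eqVneq z a'; [by left|right].
  apply/eqP/negP => /negP zb'.
  have {az za}az : a' < z by rewrite lt_neqAle eq_sym za.
  have {zb zb'}zb : z < b' by rewrite lt_neqAle zb'.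
  have [zm|/ltW mz] := leP z m.
    by have := flux_incr az zm; rewrite ltNge Jza.
  by have := flux_decr mz zb; rewrite ltNge Jzb.
- by rewrite -e ltNge Jzb.
- case: ifPn => //; rewrite -leNgt => Jab.
  have Jab' : J a' = J b' by apply/eqP; rewrite eq_le Jab -e Jza.
  have [am'|am'] := eqVneq a' m.
    rewrite e am'; apply/eqP; apply: contraPT (Jab') => /m_max.
    by rewrite am' => + e'; rewrite e' ltxx.
  have [bm'|bm'] := eqVneq b' m.
    by move: (m_max am'); rewrite -bm' Jab' ltxx.
  exfalso; apply: nab.
  have {}am' : a < m.
    by rewrite ltNge; apply: contra am' => ma; rewrite /a' min_r.
  have {}bm' : m < b.
    by rewrite ltNge; apply: contra bm' => ma; rewrite /b' max_r.
  by split=> //; move: Jab'; rewrite /a' /b' min_l ?max_l ?ltW.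
Qed.

Hypotheses (J0 : J 0 = 0) (J1 : J 1 = 0) (m01 : 0 < m < 1).

(** The intermediate value theorem on the side of [m] opposite to [u] provides the conjugate point,
    since [J u] lies between 0 and [J m]. *)
Lemma starP (u : R) : 0 <= u <= 1 -> u != m ->
  [/\ star J m u \in `[0, 1], star J m u != u & J (star J m u) = J u].
Proof.
move=> /andP[u0 u1] um; rewrite /star (negbTE um).
have [m0 m1] := andP m01.
suff : exists v, [/\ v \in `[0, 1], v != u & J v = J u].
  by move=> /(xgetPex m)[].
have [u_m|m_u|e] := ltgtP u m; last by rewrite e eqxx in um.
  have [||v] := @IVT _ J m 1 (J u) (ltW m1).
  - exact: continuous_subspaceT flux_continuous.
  - rewrite J1 ge_min le_max flux_le_max orTb andbT; apply/orP; right.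
    rewrite -J0; have [<-//|un0] := eqVneq 0 u.
    by apply/ltW/flux_incr; rewrite ?ltW// lt_neqAle un0.
  rewrite in_itv/= => /andP[mv v1] e; exists v; split=> //.
    by rewrite in_itv/= v1 andbT (le_trans (ltW m0)).
  by rewrite gt_eqF// (lt_le_trans u_m).
have [||v] := @IVT _ J 0 m (J u) (ltW m0).
- exact: continuous_subspaceT flux_continuous.
- rewrite J0 ge_min le_max flux_le_max orbT andbT; apply/orP; left.
  rewrite -J1; have [->//|un1] := eqVneq u 1.
  by apply/ltW/flux_decr; rewrite ?ltW// lt_neqAle un1.
rewrite in_itv/= => /andP[v0 vm] e; exists v; split=> //.
  by rewrite in_itv/= v0 (le_trans vm)// ltW.
by rewrite lt_eqF// (le_lt_trans vm).
Qed.

Lemma star_gt (u : R) : 0 <= u <= 1 -> u < m -> m < star J m u.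
Proof.
move=> u01 um; have [_ ne e] := starP u01 (negbT (lt_eqF um)).
rewrite ltNge; apply: contra_eqN e => sm.
by have [h|h|h] := ltgtP (star J m u) u;
  [rewrite lt_eqF ?flux_incr ?ltW|rewrite gt_eqF ?flux_incr|rewrite h eqxx in ne].
Qed.

Lemma star_lt (u : R) : 0 <= u <= 1 -> m < u -> star J m u < m.
Proof.
move=> u01 um; have [_ ne e] := starP u01 (negbT (gt_eqF um)).
rewrite ltNge; apply: contra_eqN e => sm.
by have [h|h|h] := ltgtP (star J m u) u;
  [rewrite gt_eqF ?flux_decr|rewrite lt_eqF ?flux_decr ?ltW|rewrite h eqxx in ne].
Qed.

Lemma Theta_of_eq (a b : R) : 0 <= a <= 1 -> 0 <= b <= 1 ->
  a < m -> m < b -> J a = J b -> Theta J m (a, b).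
Proof.
move=> a01 b01 am mb e; split=> //=.
have [_ _ e'] := starP a01 (negbT (lt_eqF am)); have ms := star_gt a01 am.
apply/eqP; apply: contra_eqT e; rewrite -e'.
by case: ltgtP => // h _; [rewrite lt_eqF ?flux_decr ?ltW|rewrite gt_eqF ?flux_decr ?ltW].
Qed.

(** [J] is strictly monotone on each side of [m], so comparing a datum with the conjugate of the
    other amounts to comparing values of [J]; [ltl] and [ltr] make this translation. The three cases
    then follow the branches of [quasistatic], and the tie left over is [Theta]. *)
Lemma quasistaticP (a b : R) : 0 <= a <= 1 -> 0 <= b <= 1 ->
  ~ Theta J m (a, b) -> quasistatic_value J m a b (quasistatic a b).
Proof.
move=> a01 b01 nT.
have ltl : a < m -> b < star J m a <-> J a < J (Num.max b m).
  move=> am; have [_ _ <-] := starP a01 (negbT (lt_eqF am)); have ms := star_gt a01 am.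
  have [mb|bm] := leP m b; last first.
    by split=> _; [rewrite flux_decr|rewrite (lt_trans bm)].
  split=> [h|]; first exact: flux_decr.
  by rewrite !ltNge; apply: contra; rewrite le_eqVlt => /predU1P[->//|/(flux_decr (ltW ms))/ltW].
have ltr : m < b -> star J m b < a <-> J b < J (Num.min a m).
  move=> mb; have [_ _ <-] := starP b01 (negbT (gt_eqF mb)); have sm := star_lt b01 mb.
  have [am|ma] := leP a m; last first.
    by split=> _; [rewrite flux_incr|rewrite (lt_trans sm)].
  split=> [h|]; first exact: flux_incr.
  by rewrite !ltNge; apply: contra; rewrite le_eqVlt => /predU1P[->//|/flux_incr/(_ (ltW sm))/ltW].
rewrite /quasistatic_value /quasistatic; split.
- have [am|ma] := ltP a m; have [mb|bm] := ltP m b.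
  + have [h|h|h] := ltgtP (J a) (J b).
    * by apply: Or31; split=> //; apply/ltl => //; rewrite max_l// ltW.
    * by apply: Or32; split=> //; apply/ltr => //; rewrite min_l// ltW.
    * by case: nT; exact: Theta_of_eq.
  + apply: Or31; split=> //; apply/ltl => //.
    by rewrite max_r// m_max// lt_eqF.
  + apply: Or32; split=> //; apply/ltr => //.
    by rewrite min_r// m_max// gt_eqF.
  + exact: Or33.
- by move=> [am /(ltl am)]; rewrite (min_l (ltW am)) => h; rewrite ltNge (ltW h).
- by move=> [mb /(ltr mb)]; rewrite (max_l (ltW mb)) => ->.
- by move=> [ma bm]; rewrite min_r// max_r// ltxx.
Qed.

End flux.

(** * Half entropies and the pointwise bounds they yield *)

Section half_entropy.
Context {R : realType}.
Variables (J : R -> R) (m : R).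
Hypothesis J_C2 : C2 J.
Hypothesis J_concave : forall v, derive1 (derive1 J) v < 0.
Hypothesis m_max : unique_max_point J m.

Lemma lax_pairZ (S Q : R -> R) (c : R) : 0 <= c -> lax_pair J S Q ->
  lax_pair J (fun v => S v * c) (fun v => Q v * c).
Proof.
move=> c0 [SC QC S0 e].
have h (f : R -> R) : (forall x, derivable f x 1) ->
    derive1 (fun v => f v * c) = (fun v => derive1 f v * c).
  move=> df; apply/funext => x; apply: is_derive_derive1.
  apply: (@is_derive_ext _ (c \*: f) _ _ (c *: derive1 f x)).
  - by move=> y; rewrite mulrC.
  - exact: mulrC.
  - exact/is_deriveZ/derivable_is_derive.
have C2c (f : R -> R) : C2 f -> C2 (fun v => f v * c).
  by move=> fC; apply/Cn_C2/CnM; [exact: C2_Cn|exact: Cn_cst].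
have [S1 S2 _] := SC; have [Q1 _ _] := QC.
split; [exact: C2c|exact: C2c| |].
- by move=> v; rewrite (h _ S1) (h _ S2) mulr_ge0.
- by move=> v; rewrite (h _ S1) (h _ Q1) e mulrA.
Qed.

(* [chi] is the weight of the second variable that turns the half entropy
   supported in [{(v - k) / (k' - k) > 0}] into a boundary entropy: the two
   factors are never both nonzero on the diagonal. *)
Definition chi (k k' w : R) : R := invexp 0 ((k - w) / (k' - k)).

(* Entropy flux of a smooth version of [sgn (k' - k) (v - k)_+] whose slope
   varies only between [k] and [k']; [eta] is the derivative of the entropy. *)
Definition half_flux (k k' : R) (q : R -> R) :=
  [/\ exists S, lax_pair J S q,
      boundary_flux J (fun p => q p.1 * chi k k' p.2)
    & exists2 eta : R -> R,
       (forall y : R, is_derive y 1 q (derive1 J y * eta y)) /\ q k = 0 &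
       (forall y, 0 < (y - k) / (k' - k) -> 0 < eta y * (k' - k)) /\
       (forall y, 1 <= (y - k) / (k' - k) -> eta y = eta k')].

(** The signed width [h = k' - k] treats both orientations at once. The factors [h] in [eta] and
    [h ^+ 2] in [S] compensate the derivative of [(y - k) / h], so that [S'' = b] is nonnegative for
    either sign of [h]. *)
Lemma half_flux_exists (k k' : R) : k != k' -> exists q, half_flux k k' q.
Proof.
move=> kk'; set h := k' - k.
have h0 : h != 0 by rewrite subr_eq0 eq_sym.
have [Z [dZ Z0 Zle Zc]] := @bump_primitive R 0 1 1 ler01 ler01.
have ZC n : Cn n.+1 Z by exists (bump 0 1 1) => //; exact: Cn_bump.
have ZCt : continuous Z by exact: (Cn_continuous (ZC 0%N)).
have Zgt y : 0 < y -> 0 < Z y.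
  move=> y0; rewrite -(Z0 0 (lexx _)).
  apply: (@lt_le_trans _ _ (Z (Num.min y 1))).
    apply: (is_derive_gt0_lt dZ) => [|x /andP[x0 xy]]; first by rewrite lt_min y0 ltr01.
    by apply: bump_gt0; rewrite ?ltr01// x0 (lt_le_trans xy)// ge_min lexx orbT.
  by apply: Zle; rewrite ge_min lexx.
have [W dW W0] := antiderivative ZCt Z0.
have aff (f : R -> R) (d y : R) : is_derive ((y - k) / h) 1 f d ->
    is_derive y 1 (fun y => f ((y - k) / h)) (d / h).
  move=> fd.
  apply: (@is_derive_ext _ (fun y => f (h^-1 * y + - (k / h))) _ _ (h^-1 * d)).
  - by move=> x; rewrite mulrBl mulrC.
  - exact: mulrC.
  - by apply: is_derive_affine; rewrite mulrC -mulrBl.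
have Caff n (f : R -> R) : Cn n f -> Cn n (fun y => f ((y - k) / h)).
  move=> fC; rewrite (_ : (fun y => _) = (fun y => f (h^-1 * y + - (k / h)))).
    exact: Cn_affine.
  by apply/funext => x; rewrite mulrBl [x / h]mulrC.
pose eta y := h * Z ((y - k) / h).
pose b y := bump 0 1 1 ((y - k) / h).
have deta (y : R) : is_derive y 1 eta (b y).
  have d1 := aff Z _ y (dZ _).
  apply: (@is_derive_ext _ (h \*: (fun y => Z ((y - k) / h))) _ _ (h *: (b y / h))) => //.
  by rewrite /GRing.scale /= mulrC divfK.
have etaC n : Cn n.+1 eta.
  by exists b => //; apply: Caff; exact: Cn_bump.
pose S y := h ^+ 2 * W ((y - k) / h).
have dS (y : R) : is_derive y 1 S (eta y).
  have d1 := aff W _ y (dW _).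
  apply: (@is_derive_ext _ (h ^+ 2 \*: (fun y => W ((y - k) / h))) _ _
    (h ^+ 2 *: (Z ((y - k) / h) / h))) => //.
  by rewrite /GRing.scale /= /eta expr2 -mulrA; congr (_ * _); rewrite mulrC divfK.
have eta0 y : (y - k) / h <= 0 -> eta y = 0.
  by move=> yk; rewrite /eta Z0// mulr0.
have JC := C2_Cn J_C2.
(* [antiderivative] wants an integrand that vanishes far to the left, and for [h < 0] the product
   [J' * eta] need not do so. Integration by parts replaces it by [J * b], where [b = eta'] lives
   between [k] and [k']. *)
have [||I dI I0] := @antiderivative _ (fun y => J y * b y) (Num.min k k').
- apply: (@Cn_continuous _ 0); apply: CnM.
    exact: (Cn_le (leq0n _) JC).
  by apply: Caff; exact: Cn_bump.
- move=> y; rewrite le_min => /andP[yk yk'].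
  rewrite /b bump_out ?mulr0// negb_and -!leNgt.
  move: h0; rewrite neq_lt => /orP[hn|hp].
    by rewrite ler_ndivlMr// mul1r lerB ?orbT.
  by rewrite pmulr_lle0 ?invr_gt0// subr_le0 yk.
(* The constant [I k] normalises [q k = 0], whence [q] vanishes on the whole side of [k] where [eta]
   does. *)
pose q y := J y * eta y - (I y - I k).
have dq (y : R) : is_derive y 1 q (derive1 J y * eta y).
  have d1 := is_deriveM (flux_is_derive J_C2 y) (deta y).
  apply: (@is_derive_ext _ (J * eta - (I - cst (I k))) _ _
   (J y *: b y + eta y *: derive1 J y - (J y * b y - 0))) => //.
  by rewrite /GRing.scale /=; ring.
have qk : q k = 0 by rewrite /q eta0 ?subrr ?mul0r// mulr0 subr0.
have q0 y : (y - k) / h <= 0 -> q y = 0.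
  move=> yk.
  have zero z : (y < z < k) || (k < z < y) -> derive1 J z * eta z = 0.
    move=> zyk; rewrite eta0 ?mulr0//.
    move: h0; rewrite neq_lt => /orP[hn|hp].
      move: yk; rewrite !nmulr_lle0 ?invr_lt0// !subr_ge0 => ky.
      by case/orP: zyk => /andP[z1 z2]; [rewrite (le_trans ky) ?ltW|rewrite ltW].
    move: yk; rewrite !pmulr_lle0 ?invr_gt0// !subr_le0 => ky.
    by case/orP: zyk => /andP[z1 z2]; [rewrite ltW|rewrite (le_trans _ ky) ?ltW].
  rewrite -qk; have [yk'|/ltW ky] := leP y k.
    by apply: (is_derive_eq0_eq dq) => // z zyk; rewrite zero// zyk.
  by apply/esym; apply: (is_derive_eq0_eq dq) => // z zyk; rewrite zero// zyk orbT.
have SC : Cn 2 S by exists eta.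
have J'C : Cn 1 (derive1 J).
  exists (derive1 (derive1 J)); last by case: J_C2.
  by move=> y; apply: derivable_is_derive; case: J_C2.
have QC : Cn 2 q.
  by exists (fun y => derive1 J y * eta y) => //; apply: CnM => //; exact: etaC.
have S'E : derive1 S = eta by apply/funext => y; exact: is_derive_derive1.
have eta'E : derive1 eta = b by apply/funext => y; exact: is_derive_derive1.
have lax : lax_pair J S q.
  split; [exact: Cn_C2|exact: Cn_C2| |] => v.
    by rewrite S'E eta'E bump_ge0.
  by rewrite S'E; exact: is_derive_derive1.
exists q; split; first by exists S.
- exists (fun p => S p.1 * chi k k' p.2).
  have chiC : Cn 2 (chi k k').
    rewrite (_ : chi k k' = (fun w => invexp 0 (- h^-1 * w + k / h))).
      exact/Cn_affine/Cn_invexp.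
    by apply/funext => w; rewrite /chi mulrBl mulNr addrC [w / h]mulrC.
  split; [exact: C_plane_prod|exact: C_plane_prod| |] => w.
    have chi0 : 0 <= chi k k' w by exact: invexp_ge0.
    exact: (lax_pairZ chi0 lax).
  have [wk|wk] := leP ((k - w) / h) 0.
    have chi0 : chi k k' w = 0 by rewrite /chi invexp_le0.
    rewrite /= chi0 !mulr0; split => //.
    rewrite (_ : (fun v => _) = cst 0) ?derive1_cst//.
    by apply/funext => v; rewrite mulr0.
  have {}wk : (w - k) / h <= 0.
    by rewrite -oppr_ge0 -mulNr opprB ltW.
  rewrite /= q0// /S W0// mulr0 mul0r; split=> //.
  rewrite -/S; apply: is_derive_derive1.
  apply: (@is_derive_ext _ (chi k k' w \*: S) _ _ (chi k k' w *: eta w)) => //.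
    by move=> v; rewrite mulrC.
  by rewrite eta0// scaler0.
- exists eta; split=> // y.
    move=> yk; rewrite /eta mulrAC mulr_gt0 ?Zgt//.
    by rewrite -expr2 exprn_even_gt0.
  by move=> y1; rewrite /eta; congr (_ * _); apply: Zc; rewrite ?divff.
Qed.

Section bounds.
Variables (k k' : R) (q : R -> R).
Hypothesis qP : half_flux k k' q.

(** On []k, k']] both [J'] and [eta] are positive (the slope [J'] up to [m]), so [q] is positive
    there. Beyond [k'] the function [q - eta k' * J] is constant, and [q z <= 0 < q k'] becomes
    [J z < J k']. *)
Lemma half_flux_up z : k < k' -> k' <= m -> q z <= 0 -> z <= k \/ J z <= J k'.
Proof.
move=> kk' k'm qz; have [_ _ [eta [dq qk] [eta0 eta1]]] := qP.
have h0 : 0 < k' - k by rewrite subr_gt0.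
have pos y : k < y <= k' -> 0 < q y.
  move=> /andP[ky yk']; rewrite -qk; apply: (is_derive_gt0_lt dq) => // x /andP[kx xy].
  rewrite mulr_gt0//.
    by apply: (flux_derive_gt0 J_C2 J_concave m_max); rewrite (lt_le_trans xy)// (le_trans yk').
  by rewrite -(pmulr_lgt0 _ h0) eta0// divr_gt0// subr_gt0.
have [zk|kz] := leP z k; [by left|right].
have [zk'|k'z] := leP z k'; first by move: (pos z); rewrite kz zk' ltNge qz => /(_ isT).
have c0 : 0 < eta k'.
  by rewrite -(pmulr_lgt0 _ h0) eta0// divff ?gt_eqF.
have : q k' - eta k' * J k' = q z - eta k' * J z.
  apply: (@is_derive_eq0_eq _ (fun y => q y - eta k' * J y)
    (fun y => derive1 J y * eta y - eta k' * derive1 J y)) => //.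
  - move=> y; apply: is_deriveB.
    exact: (@is_deriveZ _ _ _ J (eta k') y 1 _ (flux_is_derive J_C2 y)).
  - exact: ltW.
  - move=> y /andP[k'y _]; rewrite eta1; last by rewrite ler_pdivlMr// mul1r lerB// ltW.
    by rewrite mulrC subrr.
have := pos k'; rewrite kk' lexx => /(_ isT) qk' e.
rewrite -(ler_pM2l c0).
by move: e qk' qz; lra.
Qed.

Lemma half_flux_up_ge_max z : m <= k -> k < k' -> 0 <= q z -> z <= k.
Proof.
move=> mk kk' qz; have [_ _ [eta [dq qk] [eta0 _]]] := qP.
have h0 : 0 < k' - k by rewrite subr_gt0.
rewrite leNgt; apply/negP => kz; move: qz; rewrite leNgt => /negP; apply.
rewrite -qk -ltrN2.
apply: (@is_derive_gt0_lt _ (fun y => - q y) (fun y => - (derive1 J y * eta y))) => //.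
move=> x /andP[kx _].
rewrite oppr_gt0 nmulr_rlt0.
  by rewrite -(pmulr_lgt0 _ h0) eta0// divr_gt0// subr_gt0.
by apply: (flux_derive_lt0 J_C2 J_concave m_max); rewrite (le_lt_trans mk).
Qed.

(** Mirror image of [half_flux_up]: the entropy now lives to the left of [k], where [eta < 0], and
    [J' < 0] beyond [m] makes [q] negative on [[k', k[]. *)
Lemma half_flux_down z : m <= k' -> k' < k -> 0 <= q z -> k <= z \/ J z <= J k'.
Proof.
move=> mk' k'k qz; have [_ _ [eta [dq qk] [eta0 eta1]]] := qP.
have h0 : k' - k < 0 by rewrite subr_lt0.
have neg y : k' <= y < k -> q y < 0.
  move=> /andP[k'y yk]; rewrite -qk; apply: (is_derive_gt0_lt dq) => // x /andP[yx xk].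
  rewrite nmulr_rgt0; last first.
    by apply: (flux_derive_lt0 J_C2 J_concave m_max); rewrite (le_lt_trans _ yx)// (le_trans mk').
  rewrite -(nmulr_lgt0 _ h0) eta0// nmulr_rgt0 ?subr_lt0// invr_lt0.
  exact: h0.
have [kz|zk] := leP k z; [by left|right].
have [k'z|zk'] := leP k' z; first by move: (neg z); rewrite zk k'z ltNge qz => /(_ isT).
have c0 : eta k' < 0.
  by rewrite -(nmulr_lgt0 _ h0) eta0// divff ?lt_eqF.
have : q z - eta k' * J z = q k' - eta k' * J k'.
  apply: (@is_derive_eq0_eq _ (fun y => q y - eta k' * J y)
    (fun y => derive1 J y * eta y - eta k' * derive1 J y)) => //.
  - move=> y; apply: is_deriveB.
    exact: (@is_deriveZ _ _ _ J (eta k') y 1 _ (flux_is_derive J_C2 y)).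
  - exact: ltW.
  - move=> y /andP[_ yk']; rewrite eta1; last by rewrite ler_ndivlMr// mul1r lerB// ltW.
    by rewrite mulrC subrr.
have := neg k'; rewrite k'k lexx => /(_ isT) qk' e.
rewrite -(ler_nM2l c0).
by move: e qk' qz; lra.
Qed.

Lemma half_flux_down_le_max z : k <= m -> k' < k -> q z <= 0 -> k <= z.
Proof.
move=> km k'k qz; have [_ _ [eta [dq qk] [eta0 _]]] := qP.
have h0 : k' - k < 0 by rewrite subr_lt0.
rewrite leNgt; apply/negP => zk; move: qz; rewrite leNgt => /negP; apply.
rewrite -qk -ltrN2.
apply: (@is_derive_gt0_lt _ (fun y => - q y) (fun y => - (derive1 J y * eta y))) => //.
move=> x /andP[_ xk].
rewrite oppr_gt0 pmulr_rlt0.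
  by rewrite -(nmulr_lgt0 _ h0) eta0// nmulr_rgt0 ?subr_lt0// invr_lt0.
by apply: (flux_derive_gt0 J_C2 J_concave m_max); rewrite (lt_le_trans xk).
Qed.

End bounds.

Variable q : rat -> rat -> R -> R.
Hypothesis qP : forall k k' : rat, k != k' -> half_flux (ratr k) (ratr k') (q k k').

Let chi_pos (k k' w : R) : 0 < (k - w) / (k' - k) -> 0 < chi k k' w.
Proof. exact: invexp_gt0. Qed.

Let rat_between (x y : R) : x < y -> exists k : rat, x < ratr k < y.
Proof. by move=> /rat_in_itvoo[k]; rewrite in_itv/=; exists k. Qed.

Let rat_neq (k k' : rat) : (ratr k : R) < ratr k' -> k != k'.
Proof. by rewrite ltr_rat => /lt_eqF ->. Qed.

(** The weight [chi] is positive when [k'] lies beyond [k] as seen from [w]. Thresholds [k' < k]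
    with [k] below [min w m] give the first bound; when [w < m], thresholds [w < k < k'] close to
    [w] give the second. *)
Lemma half_flux_left_bounds w z :
  (forall k k' : rat, k != k' -> 0 < chi (ratr k) (ratr k') w -> q k k' z <= 0) ->
  Num.min w m <= z /\ J z <= J (Num.min w m).
Proof.
move=> H.
have za : Num.min w m <= z.
  rewrite leNgt; apply/negP => /rat_between[k]; rewrite lt_min => /and3P[zk kw km].
  have [|k' /andP[_ k'k]] := @rat_between (ratr k - 1) (ratr k).
    by rewrite ltrBlDr ltrDl.
  have kk' : k != k' by rewrite eq_sym rat_neq.
  have qz : q k k' z <= 0.
    apply: H => //; apply: chi_pos.
    by rewrite nmulr_rgt0 ?subr_lt0// invr_lt0 subr_lt0.
  by have := half_flux_down_le_max (qP kk') (ltW km) k'k qz; rewrite leNgt zk.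
split=> //.
have [wm|mw] := ltP w m; last by exact: flux_le_max.
rewrite leNgt; apply/negP => Jwz.
move: za; rewrite (min_l (ltW wm)) le_eqVlt => /predU1P[e|wz].
  by rewrite e ltxx in Jwz.
have [y [wy ym Jyz]] : exists y, [/\ w < y, y < m & J y < J z].
  have nJ : \forall y \near w^'+, J y < J z.
    by apply: cvgr_lt Jwz; apply: cvg_at_right_filter; exact: flux_continuous.
  near (w^'+) => y; exists y.
  by split; near: y; [exact: nbhs_right_gt|exact: nbhs_right_lt|].
(* Taking [k' < y] keeps [J k'] below [J z], and [k < z] rules out the alternative [z <= k] of
   [half_flux_up]. *)
have [k' /andP[wk' k'y]] := rat_between wy.
have [|k /andP[wk]] := @rat_between w (Num.min (ratr k') z); first by rewrite lt_min wk'.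
rewrite lt_min => /andP[kk' kz].
have k'm : ratr k' <= m by rewrite ltW// (lt_trans k'y).
have qz : q k k' z <= 0.
  apply: H; first exact: rat_neq.
  by apply: chi_pos; rewrite divr_gt0// subr_gt0.
have [|] := half_flux_up (qP (rat_neq kk')) kk' k'm qz; first by rewrite leNgt kz.
rewrite leNgt => /negP; apply; apply: lt_trans Jyz.
by apply: (flux_incr J_C2 J_concave m_max) => //; rewrite ltW.
Unshelve. all: by end_near. Qed.

Lemma half_flux_right_bounds w z :
  (forall k k' : rat, k != k' -> 0 < chi (ratr k) (ratr k') w -> 0 <= q k k' z) ->
  z <= Num.max w m /\ J z <= J (Num.max w m).
Proof.
move=> H.
have zb : z <= Num.max w m.
  rewrite leNgt; apply/negP => /rat_between[k]; rewrite gt_max => /andP[/andP[wk mk] kz].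
  have [|k' /andP[kk' _]] := @rat_between (ratr k) (ratr k + 1).
    by rewrite ltrDl.
  have qz : 0 <= q k k' z.
    apply: H; first exact: rat_neq.
    by apply: chi_pos; rewrite divr_gt0// subr_gt0.
  by have := half_flux_up_ge_max (qP (rat_neq kk')) (ltW mk) kk' qz; rewrite leNgt kz.
split=> //.
have [wm|mw] := leP w m; first by exact: flux_le_max.
rewrite leNgt; apply/negP => Jwz.
move: zb; rewrite (max_l (ltW mw)) le_eqVlt => /predU1P[e|zw].
  by rewrite e ltxx in Jwz.
have [y [yw my Jyz]] : exists y, [/\ y < w, m < y & J y < J z].
  have nJ : \forall y \near w^'-, J y < J z.
    by apply: cvgr_lt Jwz; apply: cvg_at_left_filter; exact: flux_continuous.
  near (w^'-) => y; exists y.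
  by split; near: y; [exact: nbhs_left_lt|exact: nbhs_left_gt|].
have [k' /andP[yk' k'w]] := rat_between yw.
have [|k /andP[+ kw]] := @rat_between (Num.max (ratr k') z) w; first by rewrite gt_max k'w.
rewrite gt_max => /andP[k'k zk].
have mk' : m <= ratr k' by rewrite ltW// (lt_trans my).
have kk' : k != k' by rewrite eq_sym rat_neq.
have qz : 0 <= q k k' z.
  apply: H => //.
  by apply: chi_pos; rewrite nmulr_rgt0 ?subr_lt0// invr_lt0 subr_lt0.
have [|] := half_flux_down (qP kk') mk' k'k qz; first by rewrite leNgt zk.
rewrite leNgt => /negP; apply; apply: lt_trans Jyz.
by apply: (flux_decr J_C2 J_concave m_max) => //; rewrite ltW.
Unshelve. all: by end_near. Qed.

End half_entropy.

(** * Signs almost everywhere from integrals against bumps *)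

Section bump_test.
Context {R : realType}.
Notation mu := (@lebesgue_measure R).

Lemma integrable_le_indic d (T : measurableType d) (nu : {measure set T -> \bar R})
    (f : T -> R) (A : set T) (M : R) :
  measurable A -> (nu A < +oo)%E -> measurable_fun setT f ->
  (forall x, `|f x| <= M * \1_A x) -> nu.-integrable setT (EFin \o f).
Proof.
move=> mA Aoo mf fM.
have -> : EFin \o f = (EFin \o f) \_ A.
  apply/funext => x; rewrite patchE; case: ifPn => // xA.
  have := fM x; rewrite indicE (negbTE xA) mulr0 normr_le0 => /eqP fx.
  by rewrite /= fx.
apply/(integrable_mkcond _ mA); apply: measurable_bounded_integrable => //.
  exact: measurable_funTS.
exists M; split; first exact: num_real.
move=> y My x /= Ax; apply: le_trans (ltW My).
by have := fM x; rewrite indicE mem_set// mulr1.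
Qed.

Lemma integrable_bounded_itv (f : R -> R) (a b M : R) :
  measurable_fun setT f -> (forall x, `|f x| <= M * \1_(`[a, b]%classic) x) ->
  mu.-integrable setT (EFin \o f).
Proof.
move=> mf fM; apply: (@integrable_le_indic _ _ mu f `[a, b]%classic M) => //.
by apply: compact_finite_measure; exact: segment_compact.
Qed.

Lemma measurable_bump c d r : measurable_fun setT (@bump R c d r).
Proof. by apply: continuous_measurable_fun; exact: (@Cn_bump _ 0). Qed.

Lemma mul_bump_le (y M : R) (c d r : R) (x : R) : 0 <= r -> `|y| <= M ->
  `|y * bump c d r x| <= M * \1_(`[c, d]%classic) x.
Proof.
move=> r0 yM; rewrite normrM ler_pM// ger0_norm ?bump_ge0// indicE.
case: (boolP (x \in _)) => [_|xcd]; first by rewrite bump_le1.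
rewrite bump_out//; apply: contra xcd => /andP[cx xd].
by rewrite inE/= in_itv/= !ltW.
Qed.

Lemma integrable_mul_bump (f : R -> R) (M c d r : R) : 0 <= r ->
  measurable_fun setT f -> (forall x, `|f x| <= M) ->
  mu.-integrable setT (EFin \o (fun x => f x * bump c d r x)).
Proof.
move=> r0 mf fM; apply: (@integrable_bounded_itv _ c d M).
  by apply: measurable_funM => //; exact: measurable_bump.
by move=> x; exact: mul_bump_le.
Qed.

(** Each factor is at least [1 - (r * e)^-1] because [expR y >= 1 + y]; the product is then bounded
    through [(1 - a) * (1 - b) >= 0]. *)
Lemma bump_ge (c d r e x : R) : 0 < r -> 0 < e -> c + e <= x <= d - e ->
  1 - 2 / (r * e) <= bump c d r x.
Proof.
move=> r0 e0 /andP[cx xd].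
have h y : e <= y -> 1 - (r * e)^-1 <= invexp 0 (r * y).
  move=> ey; have y0 := lt_le_trans e0 ey.
  rewrite /invexp mulr_gt0// expr0 mul1r (le_trans _ (expR_ge1Dx _))//.
  by rewrite lerB// lef_pV2 ?posrE ?mulr_gt0// ler_pM2l.
have /h h1 : e <= x - c by lra.
have /h h2 : e <= d - x by lra.
have := @invexp0_le1 R (r * (x - c)); have := @invexp0_le1 R (r * (d - x)).
rewrite /bump; move: h1 h2.
set a := invexp _ _; set b := invexp _ _; set t := (r * e)^-1.
move=> h1 h2 b1 a1.
have : 0 <= (1 - a) * (1 - b) by rewrite mulr_ge0// subr_ge0.
by move: h1 h2; rewrite -/t; lra.
Qed.

Section nonpos.
Variables (f : R -> R) (M : R) (V : set R).
Hypothesis mf : measurable_fun setT f.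
Hypothesis fM : forall x, `|f x| <= M.
Hypothesis fV : forall (c d : rat) (n : nat), ratr c < ratr d :> R ->
  `[ratr c, ratr d]%classic `<=` V ->
  \int[mu]_x (f x * bump (ratr c) (ratr d) n.+1%:R x) <= 0.

Let rat_between (x y : R) : x < y -> {k : rat | x < ratr k < y}.
Proof. by move=> /rat_in_itvoo h; apply: cid; case: h => k; rewrite in_itv/=; exists k. Qed.

(** Dominated convergence: bumps of sharpness [n + 1] whose rational endpoints close in on [c] and
    [d] from inside tend to the indicator of []c, d[]. *)
Lemma bump_test_itv (c d : R) : c < d -> `[c, d]%classic `<=` V ->
  (\int[mu]_(x in `]c, d[) (f x)%:E <= 0)%E.
Proof.
move=> cd cdV.
(* The midpoint separates the two sequences of endpoints, so [c_ n < d_ n] holds for every [n]. *)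
pose h := (c + d) / 2.
have ch : c < h by rewrite /h; lra.
have hd : h < d by rewrite /h; lra.
have n0 n : 0 < n.+1%:R^-1 :> R by rewrite invr_gt0.
have cl n : c < Num.min (c + n.+1%:R^-1) h by rewrite lt_min ltrDl n0.
have dl n : Num.max (d - n.+1%:R^-1) h < d by rewrite gt_max ltrBlDr ltrDl n0.
pose c_ n := sval (rat_between (cl n)); pose d_ n := sval (rat_between (dl n)).
have cP n : c < ratr (c_ n) /\ ratr (c_ n) < c + n.+1%:R^-1 /\ ratr (c_ n) < h.
  by rewrite /c_; case: rat_between => /= k /andP[->]; rewrite lt_min => /andP[].
have dP n : ratr (d_ n) < d /\ d - n.+1%:R^-1 < ratr (d_ n) /\ h < ratr (d_ n).
  by rewrite /d_; case: rat_between => /= k /andP[+ ->]; rewrite gt_max => /andP[].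
pose b_ n x := f x * bump (ratr (c_ n)) (ratr (d_ n)) n.+1%:R x.
have ib n : mu.-integrable setT (EFin \o b_ n) by exact: integrable_mul_bump.
have b_le0 n : (\int[mu]_x (b_ n x)%:E <= 0)%E.
  rewrite -(@fineK _ (\int[mu]_x (b_ n x)%:E)) ?lee_fin.
    apply: fV.
      by have [_ [_]] := cP n; have [_ [_]] := dP n; move=> h1 h2; exact: lt_trans h1.
    apply: subset_trans cdV; apply: subset_itv; rewrite bnd_simp ltW//.
      by have [] := cP n.
    by have [] := dP n.
  exact: (integrable_fin_num _ (ib n)).
have [|||||_ _ cvg] := @dominated_convergence _ _ _ mu setT measurableT
    (fun n => EFin \o b_ n) (EFin \o (f \_ `]c, d[))
    (fun x => (M * \1_(`[c, d]%classic) x)%:E).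
- by move=> n; case/integrableP: (ib n).
- apply/measurable_EFinP/(measurable_restrictT _ _).1 => //.
  exact: measurable_funTS.
- apply: aeW => x _; apply: cvg_EFin; first exact: nearW.
  rewrite patchE; case: ifPn => [|xcd]; last first.
    apply: cvg_near_cst; apply: nearW => n; rewrite /b_/= bump_out ?mulr0//.
    apply: contra xcd => /andP[h1 h2]; rewrite inE/= in_itv/=.
    have [h3 _] := cP n; have [h4 _] := dP n.
    by rewrite (lt_trans h3)//= (lt_trans h2).
  rewrite inE/= in_itv/= => /andP[cx xd].
  rewrite -[X in _ --> X]mulr1; apply: cvgM; first exact: cvg_cst.
  apply/cvgrPdist_le => /= e e0.
  (* Half the distance from [x] to the nearer endpoint: once [n.+1%:R^-1 <= s], the point [x] is
     still at distance at least [s] from [c_ n] and [d_ n]. *)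
  pose s := Num.min (x - c) (d - x) / 2.
  have s0 : 0 < s by rewrite divr_gt0// lt_min !subr_gt0 cx.
  near=> n.
  rewrite ger0_norm ?subr_ge0 ?bump_le1//.
  have n1 : n.+1%:R^-1 <= s.
    rewrite -[s]invrK lef_pV2 ?posrE ?invr_gt0//.
    apply: (@le_trans _ _ n%:R); last by rewrite ler_nat.
    by near: n; exact: nbhs_infty_ger.
  have [cn1 [cn2 cn3]] := cP n; have [dn1 [dn2 dn3]] := dP n.
  have sx : s *+ 2 <= x - c /\ s *+ 2 <= d - x.
    rewrite -mulr_natr divfK//; split; first by rewrite ge_min lexx.
    by rewrite ge_min lexx orbT.
  rewrite mulr2n in sx.
  rewrite lerBlDr -lerBlDl.
  apply: le_trans (@bump_ge (ratr (c_ n)) (ratr (d_ n)) n.+1%:R s x (ltr0Sn _ _) s0 _).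
    have ns0 : 0 < n.+1%:R * s by exact: mulr_gt0.
    have es0 : 0 < e * s by exact: mulr_gt0.
    rewrite lerB// ler_pdivrMr// mulrCA -ler_pdivrMr//.
    apply: (@le_trans _ _ n%:R); last by rewrite ler_nat.
    by near: n; exact: nbhs_infty_ger.
  move: sx n1 cn2 dn2 => [s1 s2]; set t := _^-1; lra.
- apply: (@integrable_le_indic _ _ mu _ `[c, d]%classic `|M|) => //.
  + by apply: compact_finite_measure; exact: segment_compact.
  + by apply: measurable_funM => //; exact: measurable_indic.
  + by move=> x; rewrite normrM ler_pM// ger0_norm.
- apply: aeW => x n _; rewrite lee_fin (le_trans (mul_bump_le _ _ _ _ (fM x)))//.
  have M0 : 0 <= M by rewrite (le_trans _ (fM x)).
  rewrite ler_wpM2l// !indicE ler_nat.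
  case: (boolP (x \in `[ratr (c_ n), ratr (d_ n)]%classic)) => //.
  rewrite inE/= in_itv/= => /andP[h1 h2].
  have [h3 _] := cP n; have [h4 _] := dP n.
  by rewrite mem_set//= in_itv/= (le_trans (ltW h3))//= (le_trans h2)// ltW.
rewrite integral_mkcond (restrict_EFin f).
by apply: cvge_le cvg; apply: nearW.
Unshelve. all: by end_near. Qed.

(** Lebesgue differentiation: at almost every point, [f] is the limit of its averages over shrinking
    balls. Around a point of [V] these balls end up inside [V], where [bump_test_itv] makes the
    averages nonpositive. *)
Lemma bump_test_ae_le0 : open V -> {ae mu, forall x, V x -> f x <= 0}.
Proof.
move=> oV.
have lf : locally_integrable setT f.
  split=> //; first exact: openT.
  move=> K _ cK; have mK : measurable K by exact: compact_measurable.
  have Koo : (mu K < +oo)%E := compact_finite_measure cK.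
  apply: (@le_lt_trans _ _ (\int[mu]_(x in K) M%:E)%E).
    apply: ge0_le_integral => //.
    - by apply/measurable_EFinP; apply: measurableT_comp => //; exact: measurable_funTS.
    - by move=> x _; rewrite lee_fin.
  rewrite integral_cst//= lte_mul_pinfty// ?lee_fin.
  by rewrite (le_trans _ (fM 0)).
have n0 n : 0 < n.+1%:R^-1 :> R by rewrite invr_gt0.
pose E (x : R) (n : nat) : set R := ball x n.+1%:R^-1.
have nE x : nicely_shrinking x (E x).
  split=> [n|]; first exact: measurable_ball.
  exists (1, fun n => PosNum (n0 n)); split=> //=.
  - exact: cvg_harmonic.
  - by move=> n y.
  - by move=> n; rewrite mul1e.
move: (lebesgue_differentiation lf).
apply: filter_app; first exact: (ae_filter_ringOfSetsType mu).
apply: aeW => x /(nice_lebesgue_differentiation nE lf) cvg Vx.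
rewrite -lee_fin; apply: cvge_le cvg.
have [r /= r0 rV] : nbhs x V by exact: open_nbhs_nbhs.
near=> n.
rewrite /E (lebesgue_measure_ball _ (ltW (n0 n))).
have n2 : 0 < n.+1%:R^-1 *+ 2 :> R by rewrite pmulrn_lgt0.
rewrite inver gt_eqF// pmule_rle0 ?lte_fin ?invr_gt0// ball_itv.
apply: bump_test_itv; first by rewrite ltrD2l gtrN.
move=> y; rewrite /= in_itv/= => /andP[y1 y2]; apply: rV => /=.
apply: (@le_lt_trans _ _ n.+1%:R^-1); first by rewrite ler_distlC y1 y2.
rewrite -[r]invrK ltf_pV2 ?posrE ?invr_gt0//.
apply: (@lt_le_trans _ _ n%:R); last by rewrite ler_nat.
by near: n; exact: nbhs_infty_gtr.
Unshelve. all: by end_near. Qed.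

End nonpos.
End bump_test.

(** * Null sets of the plane, sections and iterated integrals *)

Section ae.
Context {R : realType}.
Notation mu := (@lebesgue_measure R).

Lemma ae_impl d (T : measurableType d) (nu : {measure set T -> \bar R})
    (P Q : T -> Prop) : (forall x, P x -> Q x) ->
  {ae nu, forall x, P x} -> {ae nu, forall x, Q x}.
Proof.
move=> PQ; apply: negligibleS => x /= nQ Px; exact/nQ/PQ.
Qed.

Lemma ae_forall_countable d (T : measurableType d) (nu : {measure set T -> \bar R})
    (I : countType) (P : I -> T -> Prop) :
  (forall i, {ae nu, forall x, P i x}) -> {ae nu, forall x, forall i, P i x}.
Proof.
move=> H.
have H' n : {ae nu, forall x, if unpickle n is Some i then P i x else True}.
  by case: (unpickle n) => [i|]; [exact: H|exact: aeW].
move/ae_foralln: H'; apply: ae_impl => x Hx i.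
by move: (Hx (pickle i)); rewrite pickleK.
Qed.

Lemma ae_and d (T : measurableType d) (nu : {measure set T -> \bar R})
    (P Q : T -> Prop) : {ae nu, forall x, P x} -> {ae nu, forall x, Q x} ->
  {ae nu, forall x, P x /\ Q x}.
Proof.
have F := ae_filter_ringOfSetsType nu.
by move=> hP hQ; apply: filterI hP hQ.
Qed.

Lemma mu2_null_of_sections (A : set (R * R)) : measurable A ->
  {ae mu, forall t, {ae mu, forall x, ~ A (t, x)}} -> mu2 A = 0%E.
Proof.
move=> mA H; rewrite /mu2 /product_measure1 /=.
rewrite (@ae_eq_integral _ _ _ mu setT (cst 0%E)) ?integral0//.
  exact: measurable_fun_xsection.
move: H; apply: ae_impl => t At _ /=.
apply/negligibleP; first exact: measurable_xsection.
apply: negligibleS At => x /=.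
by rewrite /xsection /= inE => ? /(_ _).
Qed.

Lemma ae_mu2_of_sections (P : R * R -> Prop) (A : set (R * R)) :
  measurable A -> (forall p, ~ A p -> P p) ->
  {ae mu, forall t, {ae mu, forall x, ~ A (t, x)}} -> {ae mu2, forall p, P p}.
Proof.
move=> mA AP H; exists A; split => //; first exact: mu2_null_of_sections.
by move=> p /=; apply: contra_notP => /AP.
Qed.

Lemma ae_sections1 (P : R * R -> Prop) : {ae mu2, forall p, P p} ->
  {ae mu, forall t, {ae mu, forall x, P (t, x)}}.
Proof.
case=> N [mN N0 PN].
have : ae_eq mu setT (mu \o xsection N) (cst 0%E).
  apply/(@ae_eq_integral_abs _ _ _ mu _ measurableT) => //.
    exact: measurable_fun_xsection.
  rewrite -[RHS]N0 /mu2 /product_measure1 /=.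
  by apply: eq_integral => x _; rewrite gee0_abs.
apply: ae_impl => t /(_ I) /= Nt.
apply: (@negligibleS _ _ _ _ (xsection N t)).
  by move=> x /= nP; rewrite /xsection /= inE; apply: PN.
by apply/negligibleP => //; exact: measurable_xsection.
Qed.

(** The product measure is defined by integrating the sections at fixed first coordinate; the other
    sections are reached by Tonelli for the indicator of [N]. *)
Lemma ae_sections2 (P : R * R -> Prop) : {ae mu2, forall p, P p} ->
  {ae mu, forall x, {ae mu, forall t, P (t, x)}}.
Proof.
case=> N [mN N0 PN].
have : ae_eq mu setT (mu \o ysection N) (cst 0%E).
  apply/(@ae_eq_integral_abs _ _ _ mu _ measurableT) => //.
    exact: measurable_fun_ysection.
  transitivity (\int[mu]_x (mu \o ysection N) x)%E.
    by apply: eq_integral => x _; rewrite gee0_abs.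
  have := indic_fubini_tonelli mu mu mN.
  rewrite indic_fubini_tonelli_GE// indic_fubini_tonelli_FE// => <-.
  exact: N0.
apply: ae_impl => t /(_ I) /= Nt.
apply: (@negligibleS _ _ _ _ (ysection N t)).
  by move=> x /= nP; rewrite /ysection /= inE; apply: PN.
by apply/negligibleP => //; exact: measurable_ysection.
Qed.

Lemma ae_eq_Rintegral (f g : R -> R) :
  measurable_fun setT f -> measurable_fun setT g ->
  {ae mu, forall x, f x = g x} -> \int[mu]_x f x = \int[mu]_x g x.
Proof.
move=> mf mg fg; congr fine; apply: ae_eq_integral => //.
- exact/measurable_EFinP.
- exact/measurable_EFinP.
- by move: fg; apply: ae_impl => x /= -> _.
Qed.

Lemma ae_le_Rintegral (f g : R -> R) :
  mu.-integrable setT (EFin \o f) -> mu.-integrable setT (EFin \o g) ->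
  {ae mu, forall x, f x <= g x} -> \int[mu]_x f x <= \int[mu]_x g x.
Proof.
move=> fi gi fg; rewrite -subr_ge0 -RintegralB//.
have mf : measurable_fun setT f by apply/measurable_EFinP; case/integrableP: fi.
have mg : measurable_fun setT g by apply/measurable_EFinP; case/integrableP: gi.
rewrite (@ae_eq_Rintegral _ (fun x => Num.max (g x - f x) 0)).
- by apply: Rintegral_ge0 => x _; rewrite le_max lexx orbT.
- exact: measurable_funB.
- by apply: measurable_maxr => //; exact: measurable_funB.
- by move: fg; apply: ae_impl => x h; rewrite max_l// subr_ge0.
Qed.

End ae.

Section fubini.
Context {R : realType}.
Notation mu := (@lebesgue_measure R).

(** Tonelli applies to the positive and negative parts separately, and [fine] of their difference is
    measurable even where sections have infinite integrals. *)
Lemma Rintegral_measurable_section1 (f : R * R -> R) :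
  measurable_fun setT f -> measurable_fun setT (fun t => \int[mu]_x f (t, x)).
Proof.
move=> mf.
have m1 (g : R * R -> \bar R) : measurable_fun setT g -> (forall p, 0 <= g p)%E ->
    measurable_fun setT (fun t => \int[mu]_x g (t, x))%E.
  by move=> mg g0; exact: (@measurable_fun_fubini_tonelli_F _ _ _ _ _ mu g).
rewrite (_ : (fun t => _) = (fun t => fine
   (\int[mu]_x ((EFin \o f)^\+ (t, x)) - \int[mu]_x ((EFin \o f)^\- (t, x)))%E)).
  apply: measurableT_comp; first exact: fine_measurable.
  apply: emeasurable_funB; apply: m1 => //.
  - by apply: measurable_funepos; exact/measurable_EFinP.
  - by apply: measurable_funeneg; exact/measurable_EFinP.
apply/funext => t; rewrite /Rintegral integralE.
by congr (fine (_ - _))%E; apply: eq_integral => x _; rewrite ?funeposE ?funenegE.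
Qed.

Lemma Rintegral_measurable_section2 (f : R * R -> R) :
  measurable_fun setT f -> measurable_fun setT (fun x => \int[mu]_t f (t, x)).
Proof.
move=> mf; apply: (@Rintegral_measurable_section1 (f \o (fun p => (p.2, p.1)))).
by apply: measurableT_comp => //; exact: measurable_swap.
Qed.

Lemma ae_eq_iterated_Rintegral (f g : R * R -> R) :
  measurable_fun setT f -> measurable_fun setT g ->
  {ae mu2, forall p, f p = g p} ->
  \int[mu]_t (\int[mu]_x f (t, x)) = \int[mu]_t (\int[mu]_x g (t, x)).
Proof.
move=> mf mg /ae_sections1 fg; apply: ae_eq_Rintegral.
- exact: Rintegral_measurable_section1.
- exact: Rintegral_measurable_section1.
move: fg; apply: ae_impl => t h; apply: ae_eq_Rintegral => //.
- exact: measurableT_comp.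
- exact: measurableT_comp.
Qed.

Lemma Rintegral_swap (f : R * R -> R) (a b c d M : R) :
  measurable_fun setT f ->
  (forall t x, `|f (t, x)| <= M * \1_(`[a, b]%classic) t * \1_(`[c, d]%classic) x) ->
  \int[mu]_t (\int[mu]_x f (t, x)) = \int[mu]_x (\int[mu]_t f (t, x)).
Proof.
move=> mf fM.
have i1 t : mu.-integrable setT (EFin \o (fun x => f (t, x))).
  apply: (@integrable_bounded_itv _ _ c d (M * \1_(`[a, b]%classic) t)) => //.
  exact: measurableT_comp.
have i2 x : mu.-integrable setT (EFin \o (fun t => f (t, x))).
  apply: (@integrable_bounded_itv _ _ a b (M * \1_(`[c, d]%classic) x)) => //.
    exact: measurableT_comp.
  by move=> t; rewrite mulrAC.
have i3 : (mu \x mu)%E.-integrable setT (EFin \o f).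
  apply: (@integrable_le_indic _ _ _ (mu \x mu)%E f (`[a, b] `*` `[c, d])%classic M) => //.
  - exact: measurableX.
  - have h : (mu `[a, b]%classic * mu `[c, d]%classic < +oo)%E.
      by apply: lte_mul_pinfty => //; [rewrite ge0_fin_numE//|];
        apply: compact_finite_measure; exact: segment_compact.
    refine (eq_ind_r (fun z => z < +oo)%E h _).
    exact: product_measure1E.
  - move=> [t x]; rewrite (le_trans (fM t x))// -mulrA -natrM mulnb !indicE.
    by rewrite in_setX.
rewrite /Rintegral; congr fine.
transitivity (\int[mu]_t \int[mu]_x (f (t, x))%:E)%E.
  by apply: eq_integral => t _; rewrite fineK//; exact: integrable_fin_num (i1 t).
rewrite (Fubini i3).
by apply: eq_integral => t _; rewrite fineK//; exact: integrable_fin_num (i2 t).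
Qed.

End fubini.

(** * Product bumps in the plane and concentration at the boundary *)

Section bump_test2.
Context {R : realType}.
Notation mu := (@lebesgue_measure R).
Variables (D : R * R -> R) (M : R).
Hypothesis mD : measurable_fun setT D.
Hypothesis DM : forall p, `|D p| <= M.

Let M0 : 0 <= M. Proof. by rewrite (le_trans _ (DM (0, 0))). Qed.

Lemma integrable_cst_indic (K a b : R) :
  mu.-integrable setT (EFin \o (fun x => K * \1_(`[a, b]%classic) x)).
Proof.
apply: (@integrable_bounded_itv _ _ a b `|K|).
  by apply: measurable_funM => //; exact: measurable_indic.
by move=> x; rewrite normrM ler_pM// ger0_norm.
Qed.

Lemma Rintegral_cst_indic (K a b : R) : a <= b ->
  \int[mu]_x (K * \1_(`[a, b]%classic) x) = K * (b - a).
Proof.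
move=> ab; transitivity (\int[mu]_(x in `[a, b]) K).
  rewrite [RHS]Rintegral_mkcond; apply: eq_Rintegral => x _.
  by rewrite patchE indicE; case: ifP => _; rewrite (mulr1, mulr0).
rewrite Rintegral_cst//; congr (_ * _).
have e : lebesgue_measure `[a, b]%classic = (b - a)%:E.
  by rewrite lebesgue_measure_itv/= lte_fin; case: ltgtP ab => // ->; rewrite subrr.
exact: (congr1 fine e).
Qed.

Lemma Rintegral_mul_bump_bound (f : R -> R) (c d r : R) : c <= d -> 0 <= r ->
  measurable_fun setT f -> (forall x, `|f x| <= M) ->
  `|\int[mu]_x (f x * bump c d r x)| <= M * (d - c).
Proof.
move=> cd r0 mf fM.
have i := integrable_mul_bump c d r0 mf fM.
apply: le_trans (le_normr_Rintegral measurableT i) _.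
rewrite -Rintegral_cst_indic//; apply: le_Rintegral => //.
- exact: (@integrable_norm _ _ _ mu _ _ i).
- exact: integrable_cst_indic.
- by move=> x _; exact: mul_bump_le.
Qed.

Let mD1 t : measurable_fun setT (fun x => D (t, x)).
Proof. exact: measurableT_comp. Qed.

Let mD2 x : measurable_fun setT (fun t => D (t, x)).
Proof. exact: measurableT_comp. Qed.

Let mDbump1 a b s : measurable_fun setT (fun p => D p * bump a b s p.1).
Proof.
apply: measurable_funM => //; apply: measurableT_comp => //.
exact: measurable_bump.
Qed.

Let mDbump2 a b s : measurable_fun setT (fun p => D p * bump a b s p.2).
Proof.
apply: measurable_funM => //; apply: measurableT_comp => //.
exact: measurable_bump.
Qed.

Lemma bump_pairing_swap (a b s c d r : R) : 0 <= s -> 0 <= r ->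
  \int[mu]_t (\int[mu]_x (D (t, x) * bump a b s t * bump c d r x)) =
  \int[mu]_x ((\int[mu]_t (D (t, x) * bump a b s t)) * bump c d r x).
Proof.
move=> s0 r0.
rewrite (@Rintegral_swap _ (fun p => D p * bump a b s p.1 * bump c d r p.2) a b c d M).
- apply: eq_Rintegral => x _ /=.
  have i := integrable_mul_bump a b s0 (mD2 x) (fun t => DM (t, x)).
  exact: (RintegralZr (bump c d r x) measurableT i).
- apply: measurable_funM => //; apply: measurableT_comp => //.
  exact: measurable_bump.
- move=> t x /=; rewrite (le_trans (@mul_bump_le _ _ (M * \1_(`[a, b]%classic) t) _ _ _ _ r0 _))//.
  exact: mul_bump_le.
Qed.

Lemma bump_pairing_factor (a b s c d r : R) : 0 <= s -> 0 <= r ->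
  \int[mu]_t (\int[mu]_x (D (t, x) * bump a b s t * bump c d r x)) =
  \int[mu]_t ((\int[mu]_x (D (t, x) * bump c d r x)) * bump a b s t).
Proof.
move=> s0 r0; apply: eq_Rintegral => t _.
have i := integrable_mul_bump c d r0 (mD1 t) (fun x => DM (t, x)).
apply: etrans (RintegralZr (bump a b s t) measurableT i).
by apply: eq_Rintegral => x _; rewrite mulrAC.
Qed.

(** The one-dimensional test is used twice. Applied in [t] to the integrals against each of
    countably many bumps in [x], it leaves one null set of times for all of them; at every other
    time of [V] it is applied in [x]. *)
Lemma bump_test2_ae_le0 (V W : set R) : open V -> open W ->
  (forall (a b c d : rat) (n k : nat), ratr a < ratr b :> R -> ratr c < ratr d :> R ->
    `[ratr a, ratr b]%classic `<=` V -> `[ratr c, ratr d]%classic `<=` W ->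
    \int[mu]_t (\int[mu]_x (D (t, x) * bump (ratr a) (ratr b) n.+1%:R t *
      bump (ratr c) (ratr d) k.+1%:R x)) <= 0) ->
  {ae mu2, forall p : R * R, V p.1 -> W p.2 -> D p <= 0}.
Proof.
move=> oV oW H.
pose F (i : rat * rat * nat) (t : R) :=
  \int[mu]_x (D (t, x) * bump (ratr i.1.1) (ratr i.1.2) i.2.+1%:R x).
have HF : {ae mu, forall t, forall i : rat * rat * nat,
    ratr i.1.1 < ratr i.1.2 :> R -> `[ratr i.1.1, ratr i.1.2]%classic `<=` W ->
    V t -> F i t <= 0}.
  apply: ae_forall_countable => -[[c d] k] /=.
  have [cd|dc] := ltP (ratr c : R) (ratr d); last by apply: aeW => t.
  have [cdW|cdW] := pselect (`[ratr c, ratr d]%classic `<=` W); last by apply: aeW => t.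
  suff : {ae mu, forall t, V t -> F (c, d, k) t <= 0}.
    by apply: ae_impl => t Ft _ _ Vt; exact: Ft.
  apply: (@bump_test_ae_le0 _ (F (c, d, k)) (M * (ratr d - ratr c)) V) oV.
  - exact: (@Rintegral_measurable_section1 _
      (fun p => D p * bump (ratr c) (ratr d) k.+1%:R p.2)).
  - by move=> t; apply: Rintegral_mul_bump_bound => //; exact: ltW.
  - move=> a b n ab abV; rewrite /F /= -bump_pairing_factor//.
    exact: H.
pose A := [set p | [/\ V p.1, W p.2 & 0 < D p]].
apply: (@ae_mu2_of_sections _ _ A).
- rewrite (_ : A = ((V `*` W) `&` (D @^-1` `]0, +oo[))%classic).
    apply: measurableI.
      by apply: measurableX; exact: open_measurable.
    by rewrite -[X in measurable X]setTI; exact: mD.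
  apply/seteqP; split => [p [? ? ?]|p [[? ?]]]; last by rewrite /= in_itv/= andbT.
  by split=> //=; rewrite in_itv/= andbT.
- move=> p nA Vp Wp; rewrite leNgt; apply/negP => Dp.
  exact: nA.
move: HF; apply: ae_impl => t Ht.
have [Vt|nVt] := pselect (V t); last by apply: aeW => x [].
have : {ae mu, forall x, W x -> D (t, x) <= 0}.
  apply: (@bump_test_ae_le0 _ (fun x => D (t, x)) M W (mD1 t) (fun x => DM (t, x)) _ oW).
  move=> c d n cd cdW.
  exact: (Ht (c, d, n)).
apply: ae_impl => x hx [/= _ Wx]; rewrite ltNge => /negP; apply; exact: hx.
Qed.

(* Concentrating the test function [bump c d r] at the boundary point [x0]
   replaces the integral of [D] by its essential limit there. *)
Lemma bump_pairing_le0_of_trace (x0 a b s c d r : R) :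
  0 <= x0 <= 1 -> 0 <= s -> 0 <= r -> 0 < c -> c < d -> d < 1 ->
  (forall l, 1 <= l ->
    \int[mu]_t (\int[mu]_x (D (t, x) * bump a b s t * bump c d r x)) <=
    l * \int[mu]_t (\int[mu]_x (D (t, x) * bump a b s t *
       bump (x0 + (c - x0) / l) (x0 + (d - x0) / l) (l * r) x))) ->
  (forall e, 0 < e -> exists2 de, 0 < de & {ae mu, forall x, 0 < x < 1 ->
     `|x - x0| < de -> \int[mu]_t (D (t, x) * bump a b s t) <= e}) ->
  \int[mu]_t (\int[mu]_x (D (t, x) * bump a b s t * bump c d r x)) <= 0.
Proof.
move=> /andP[x00 x01] s0 r0 c0 cd d1 H1 H2.
apply/ler_addgt0Pl => e e0; rewrite addr0.
have [de de0 Hde] := H2 _ e0.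
(* Chosen so that [l >= 1] and [l^-1 < de]: the rescaled bump then lives within [de] of [x0]. *)
pose l := 1 + de^-1 *+ 2.
have dV0 : 0 < de^-1 by rewrite invr_gt0.
have l1 : 1 <= l by rewrite lerDl mulrn_wge0// ltW.
have l0 : 0 < l by rewrite (lt_le_trans ltr01).
have lV : l^-1 < de.
  rewrite -[de]invrK ltf_pV2 ?posrE// /l mulr2n; lra.
have lV1 : l^-1 <= 1 by rewrite invf_le1.
have lV0 : 0 < l^-1 by rewrite invr_gt0.
apply: (le_trans (H1 l l1)).
rewrite bump_pairing_swap//; last exact: mulr_ge0 (ltW l0) r0.
set c' := x0 + _; set d' := x0 + _.
have dc' : d' - c' = (d - c) / l by rewrite /d' /c'; ring.
have cd' : c' <= d' by rewrite -subr_ge0 dc' divr_ge0 ?subr_ge0 ?ltW.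
pose G x := \int[mu]_t (D (t, x) * bump a b s t).
have mG : measurable_fun setT G.
  exact: (@Rintegral_measurable_section2 _ (fun p => D p * bump a b s p.1)).
pose K := M * `|b - a|.
have GK x : `|G x| <= K.
  have [ab|ba] := leP a b.
    rewrite /K (@ger0_norm _ (b - a)) ?subr_ge0//.
    exact: (Rintegral_mul_bump_bound ab s0 (mD2 x) (fun t => DM (t, x))).
  rewrite /G (@eq_Rintegral _ _ _ _ _ (cst 0)) ?Rintegral_cst ?mul0r ?normr0 ?mulr_ge0//.
  move=> t _; rewrite bump_out ?mulr0//.
  by apply/negP => /andP[at1 /(lt_trans at1)]; rewrite ltNge ltW.
have iG := integrable_mul_bump c' d' (mulr_ge0 (ltW l0) r0) mG GK.
rewrite -RintegralZl//.
apply: (@le_trans _ _ (\int[mu]_x (l * e * \1_(`[c', d']%classic) x))).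
  apply: ae_le_Rintegral.
  - rewrite (_ : _ \o _ = EFin \o (fun x => (l * G x) * bump c' d' (l * r) x)).
      apply: (@integrable_mul_bump _ _ (l * K)).
      + exact: mulr_ge0 (ltW l0) r0.
      + exact: measurable_funM.
      + by move=> x; rewrite normrM gtr0_norm// ler_pM2l.
    by apply/funext => x /=; rewrite mulrA.
  - exact: integrable_cst_indic.
  - move: Hde; apply: ae_impl => x Hx.
    have [xcd|xcd] := boolP (c' < x < d'); last first.
      have -> : bump c' d' (l * r) x = 0.
        by apply: bump_out => //; exact: mulr_ge0 (ltW l0) r0.
      by rewrite !mulr0 mulr_ge0//; exact: mulr_ge0 (ltW l0) (ltW e0).
    (* Written as convex combinations of [x0] with [c] and [d], the rescaled endpoints visibly stay
       inside []0, 1[]. *)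
    have xx0 : x0 * (1 - l^-1) + c * l^-1 < x /\ x < x0 * (1 - l^-1) + d * l^-1.
      by move: xcd; rewrite /c' /d' => /andP[h1 h2]; split; lra.
    have lV2 : 0 <= 1 - l^-1 by rewrite subr_ge0.
    have [h1 h2] : 0 < x /\ x < 1.
      have [h3 h4] := xx0; split.
        by apply: lt_trans h3; rewrite ltr_wpDl ?mulr_ge0 ?mulr_gt0.
      apply: (lt_trans h4); rewrite -[ltRHS](subrK l^-1).
      by rewrite ler_ltD ?ler_piMl// gtr_pMl.
    have h5 : `|x - x0| < de.
      apply: le_lt_trans lV; rewrite ler_distlC; move: xcd; rewrite /c' /d'.
      have : - l^-1 <= (c - x0) / l.
        by rewrite -mulN1r ler_pM2r//; lra.
      have : (d - x0) / l <= l^-1.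
        by rewrite -[leRHS]mul1r ler_pM2r//; lra.
      by move=> h3 h4 /andP[h6 h7]; apply/andP; split; lra.
    have Gx : G x <= e by apply: Hx => //; rewrite h1 h2.
    rewrite -mulrA ler_pM2l// indicE mem_set ?mulr1; last first.
      by rewrite /= in_itv/=; case/andP: xcd => /ltW -> /ltW ->.
    have b0 := @bump_ge0 _ c' d' (l * r) x.
    have b1 := @bump_le1 _ c' d' (l * r) x.
    apply: (@le_trans _ _ (e * bump c' d' (l * r) x)); first by rewrite ler_wpM2r.
    by rewrite ler_piMr// ltW.
(* The support has shrunk to length [(d - c) / l], which cancels the factor [l] and leaves
   [e * (d - c) <= e]. *)
rewrite Rintegral_cst_indic// dc'.
have -> : l * e * ((d - c) / l) = e * (d - c) by field; rewrite gt_eqF.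
by rewrite ger_pMr//; lra.
Qed.

End bump_test2.

Section reflection.
Context {R : realType}.
Notation mu := (@lebesgue_measure R).

Let refl (x : R) : R := 1 - x.

Let mrefl : measurable_fun setT (refl : measurableTypeR R -> measurableTypeR R).
Proof. by apply: measurable_funB. Qed.

(** Invariance of Lebesgue measure under the reflection is checked on half-open intervals and
    extended by uniqueness of the measure. *)
Lemma ae_onem (P : R -> Prop) :
  {ae mu, forall x, P x} -> {ae mu, forall x, P (1 - x)}.
Proof.
case=> N [mN N0 PN].
exists (refl @^-1` N); split.
- by rewrite -[X in measurable X]setTI; exact: mrefl.
- transitivity (pushforward mu (refl : _ -> measurableTypeR R) N); first by [].
  rewrite -[RHS]N0; apply/esym/lebesgue_measure_unique => //= _ [[a b]] _ <-.
  rewrite /pushforward/= (_ : refl @^-1` _ = `[1 - b, 1 - a[%classic).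
    by rewrite !lebesgue_measure_itv/= !lte_fin ltrD2l ltrN2 -!EFinD; congr (if _ then (_)%:E else _); ring.
  by apply/seteqP; split => x /=; rewrite !in_itv/= /refl => /andP[h1 h2]; apply/andP; split; lra.
- by move=> x /= nP; apply: PN.
Qed.

End reflection.

(** * Test functions near one end of the interval *)

Section test_functions.
Context {R : realType}.
Notation mu := (@lebesgue_measure R).

Lemma closure_supp_itv (f : R * R -> R) (a b c d : R) :
  (forall p, f p != 0 -> [/\ a <= p.1, p.1 <= b, c <= p.2 & p.2 <= d]) ->
  supp f `<=` (`[a, b] `*` `[c, d])%classic.
Proof.
move=> H; rewrite /supp.
have cl : closed (`[a, b] `*` `[c, d] : set (R * R))%classic.
  rewrite (_ : _ `*` _ = fst @^-1` `[a, b]%classic `&` snd @^-1` `[c, d]%classic)//.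
  apply: closedI; apply: closed_comp; try exact: itv_closed.
    by move=> p _; exact: cvg_fst.
  by move=> p _; exact: cvg_snd.
rewrite [X in _ `<=` X](closure_id _).1//; apply: closure_subset => p /= /H[h1 h2 h3 h4].
by split; rewrite /= in_itv/=; apply/andP.
Qed.

Lemma test_function_prod (f g : R -> R) (a b c d : R) :
  (forall k, Cn k f) -> (forall k, Cn k g) ->
  0 < a -> 0 < c -> d < 1 ->
  (forall t, f t != 0 -> a <= t <= b) -> (forall x, g x != 0 -> c <= x <= d) ->
  test_function (fun p => f p.1 * g p.2).
Proof.
move=> fC gC a0 c0 d1 f0 g0.
have S : supp (fun p => f p.1 * g p.2) `<=` (`[a, b] `*` `[c, d])%classic.
  apply: closure_supp_itv => p; rewrite mulf_eq0 negb_or => /andP[/f0 h1 /g0 h2].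
  by case/andP: h1 => ? ?; case/andP: h2.
split.
- by move=> k; apply: C_plane_prod.
- apply: (@subclosed_compact _ _ (`[a, b] `*` `[c, d])%classic) => //.
    exact: closed_closure.
  by apply: compact_setX; exact: segment_compact.
- apply: subset_trans S _ => p [/= h1 h2]; split => /=; rewrite in_itv/= ?andbT.
    by apply: lt_le_trans a0 _; move: h1; rewrite in_itv/= => /andP[].
  move: h2; rewrite in_itv/= => /andP[h3 h4].
  by rewrite (lt_le_trans c0)//= (le_lt_trans h4).
Qed.

Lemma partial2_prod (f g g' : R -> R) (p : R * R) :
  (forall x : R, is_derive x 1 g (g' x)) ->
  partial2 (fun p => f p.1 * g p.2) p = f p.1 * g' p.2.
Proof.
move=> gg'.
suff h : is_derive p.2 1 (fun y => f p.1 * g y) (f p.1 * g' p.2).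
  exact: (@is_derive_slice2 _ (fun p => f p.1 * g p.2) p _ h).2.
exact: is_deriveZ.
Qed.

(* The primitive [psi] of [l * bump' - bump], where [bump'] is [bump] rescaled
   by [l] towards [x0], vanishes near 0 and 1 and has a constant sign because
   the primitive of [bump] is nondecreasing. *)
Lemma collar_test (x0 c d r l : R) : x0 = 0 \/ x0 = 1 -> 0 <= r ->
  0 < c -> c < d -> d < 1 -> 1 <= l ->
  exists psi : R -> R, exists c' d' : R,
    [/\ forall k, Cn k psi, 0 < c' /\ d' < 1,
        forall x, psi x != 0 -> c' <= x <= d',
        forall x, 0 <= (1 - x0 *+ 2) * psi x
      & forall x : R, is_derive x 1 psi
          (l * bump (x0 + (c - x0) / l) (x0 + (d - x0) / l) (l * r) x - bump c d r x)].
Proof.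
move=> x0P r0 c0 cd d1 l1.
have l0 : 0 < l by rewrite (lt_le_trans ltr01).
have ln0 : l != 0 by rewrite gt_eqF.
have [Z [dZ Z0 Zle Zc]] := bump_primitive (ltW cd) r0.
have ZC k : Cn k Z.
  by apply: (@Cn_S _ k); exists (bump c d r) => //; exact: Cn_bump.
pose s x := l * x + (x0 - l * x0).
have sE x : s x = x0 + l * (x - x0) by rewrite /s; ring.
exists (fun x => Z (s x) + (-1) * Z x).
(* The difference vanishes where [x] and [s x] are both before the step of [Z] or both after it. For
   [x0 = 0] the point [s x] runs ahead of [x] and reaches [c] at [c / l]; for [x0 = 1] it lags
   behind and reaches [d] at [1 - (1 - d) / l]. *)
exists (if x0 == 0 then c / l else c), (if x0 == 0 then d else 1 - (1 - d) / l).
have lV0 : 0 < l^-1 by rewrite invr_gt0.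
have lV1 : l^-1 <= 1 by rewrite invf_le1.
have n10 : (1 == 0 :> R) = false by rewrite oner_eq0.
split.
- move=> k; apply: CnD; first exact: Cn_affine.
  by apply: CnM => //; exact: Cn_cst.
- case: x0P => ->; rewrite ?eqxx ?n10; first by rewrite divr_gt0.
  by split=> //; rewrite ltrBlDr ltrDl divr_gt0// subr_gt0.
- move=> x; apply: contraNT; rewrite negb_and -!ltNge => h.
  suff : Z (s x) = Z x by move=> ->; rewrite mulN1r subrr.
  case: x0P h => x0E; rewrite sE x0E ?eqxx ?n10 => /orP[h|h].
  + have h' : x < c.
      by apply: lt_le_trans h _; rewrite ler_piMr// ltW.
    rewrite add0r subr0 !Z0 ?ltW//.
    by rewrite mulrC -ltr_pdivlMr.
  + rewrite add0r subr0; apply: Zc; last exact: ltW.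
    apply: le_trans (ltW h) _; rewrite ler_peMl//.
    by rewrite (le_trans _ (ltW h))// (le_trans (ltW c0))// ltW.
  + have h' : 1 + l * (x - 1) <= x.
      rewrite -subr_ge0 (_ : _ - _ = (l - 1) * (1 - x)); last by ring.
      by rewrite mulr_ge0// subr_ge0//; lra.
    by rewrite !Z0 ?ltW// (le_lt_trans h').
  + have h' : d < x.
      apply: le_lt_trans h; rewrite lerBrDl -lerBrDr.
      by rewrite ler_piMr// subr_ge0 ltW.
    apply: Zc; last exact: ltW.
    have : (1 - d) / l > 1 - x by lra.
    by rewrite ltr_pdivlMr// => h''; lra.
- move=> x; case: x0P => x0E; rewrite sE x0E.
    rewrite (_ : 0 + l * (x - 0) = l * x); last by ring.
    rewrite mul0rn subr0 mul1r mulN1r subr_ge0.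
    have [x_le0|x_gt0] := leP x 0.
      have x_lec : x <= c by exact: le_trans x_le0 (ltW c0).
      have lx_lec : l * x <= c by apply: le_trans (ltW c0); rewrite pmulr_rle0.
      by rewrite (Z0 _ x_lec) (Z0 _ lx_lec).
    by apply: Zle; rewrite ler_peMl// ltW.
  rewrite (_ : 1 - 1 *+ 2 = -1); last by rewrite mulr2n; ring.
  rewrite mulN1r oppr_ge0 mulN1r subr_le0.
  have [x_le1|x_gt1] := leP x 1.
    apply: Zle; rewrite -subr_ge0 (_ : _ - _ = (l - 1) * (1 - x)); last by ring.
    by rewrite mulr_ge0// subr_ge0.
  rewrite (Zc _ x)//; last by rewrite ltW// (lt_trans d1).
  by rewrite (le_trans (ltW d1))// lerDl mulr_ge0 ?subr_ge0 ?ltW.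
- move=> x.
  have dZs := is_derive_affine (dZ (s x)).
  apply: (@is_derive_ext _ ((fun x => Z (s x)) - Z) _ _
    (l * bump c d r (s x) - bump c d r x)).
  + by move=> y; rewrite mulN1r.
  (* Dilating the argument by [l] about [x0] pulls the endpoints towards [x0] and multiplies the
     sharpness by [l]. *)
  + congr (l * _ - _); rewrite /bump; congr (invexp 0 _ * invexp 0 _); rewrite sE; field.
      exact: ln0.
    exact: ln0.
Qed.

Lemma iterated_Rintegral_mkcond (A B : set R) (f : R -> R -> R) :
  \int[mu]_(t in A) (\int[mu]_(x in B) f t x) =
  \int[mu]_t (\int[mu]_x ((fun p => f p.1 p.2) \_ (A `*` B)) (t, x)).
Proof.
rewrite Rintegral_mkcond; apply: eq_Rintegral => t _.
rewrite patchE; case: ifPn => At.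
  rewrite Rintegral_mkcond; apply: eq_Rintegral => x _.
  by rewrite !patchE in_setX At.
rewrite (@eq_Rintegral _ _ _ _ _ (cst 0)) ?Rintegral_cst ?mul0r// => x _.
by rewrite patchE in_setX (negbTE At).
Qed.

End test_functions.

(** * From essential limits at the boundary to signs inside *)

Section trace_sign.
Context {R : realType}.
Notation mu := (@lebesgue_measure R).

Lemma bump_pairing_sub (D : R * R -> R) (M : R) (a b s c d r c' d' r' l : R) :
  measurable_fun setT D -> (forall p, `|D p| <= M) ->
  0 <= s -> 0 <= r -> 0 <= r' -> c <= d -> c' <= d' ->
  \int[mu]_t (\int[mu]_x (D (t, x) * bump a b s t *
     (l * bump c' d' r' x - bump c d r x))) =
  l * \int[mu]_t (\int[mu]_x (D (t, x) * bump a b s t * bump c' d' r' x)) -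
  \int[mu]_t (\int[mu]_x (D (t, x) * bump a b s t * bump c d r x)).
Proof.
move=> mD DM s0 r0 r'0 cd cd'.
have M0 : 0 <= M by rewrite (le_trans _ (DM (0, 0))).
have mD1 t : measurable_fun setT (fun x => D (t, x)) by exact: measurableT_comp.
have mDa t : measurable_fun setT (fun x => D (t, x) * bump a b s t).
  exact: measurable_funM.
have DMa t x : `|D (t, x) * bump a b s t| <= M.
  rewrite normrM -[leRHS]mulr1 ler_pM// ger0_norm ?bump_ge0//.
  exact: bump_le1.
have ix e f z (z0 : 0 <= z) t := integrable_mul_bump e f z0 (mDa t) (DMa t).
have it e f z : 0 <= z -> e <= f -> mu.-integrable setT (EFin \o (fun t =>
    \int[mu]_x (D (t, x) * bump a b s t * bump e f z x))).
  move=> z0 ef.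
  rewrite (_ : (fun t => _) = fun t =>
     (\int[mu]_x (D (t, x) * bump e f z x)) * bump a b s t).
    apply: (@integrable_mul_bump _ _ (M * (f - e))) => //.
      apply: (@Rintegral_measurable_section1 _ (fun p => D p * bump e f z p.2)).
      apply: measurable_funM => //; apply: measurableT_comp => //.
      exact: measurable_bump.
    by move=> t; apply: Rintegral_mul_bump_bound => //; exact: DM.
  apply/funext => t.
  have i := integrable_mul_bump e f z0 (mD1 t) (fun x => DM (t, x)).
  apply: etrans (RintegralZr (bump a b s t) measurableT i).
  by apply: eq_Rintegral => x _; rewrite mulrAC.
have i1 := it c' d' r' r'0 cd'; have i2 := it c d r r0 cd.
rewrite -(RintegralZl l measurableT i1).
have i3 : mu.-integrable setT (EFin \o (fun t =>
    l * \int[mu]_x (D (t, x) * bump a b s t * bump c' d' r' x))).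
  have := integrableZl measurableT l i1.
  by apply: eq_integrable => // t _; rewrite /= EFinM.
rewrite -(RintegralB measurableT i3 i2).
apply: eq_Rintegral => t _.
rewrite -(RintegralZl l measurableT (ix _ _ _ r'0 t)).
have i4 : mu.-integrable setT (EFin \o (fun x =>
    l * (D (t, x) * bump a b s t * bump c' d' r' x))).
  have := integrableZl measurableT l (ix c' d' r' r'0 t).
  by apply: eq_integrable => // x _; rewrite /= EFinM.
rewrite -(RintegralB measurableT i4 (ix c d r r0 t)).
by apply: eq_Rintegral => x _; ring.
Qed.

Lemma clip_itv (t a b : R) : a <= b -> a <= Num.max a (Num.min t b) <= b.
Proof. by move=> ab; rewrite le_max lexx ge_max ab ge_min lexx orbT. Qed.

Lemma clip_id (t a b : R) : a <= t <= b -> Num.max a (Num.min t b) = t.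
Proof. by case/andP=> h1 h2; rewrite min_l// max_r. Qed.

Lemma clip_continuous (a b : R) : continuous (fun t : R => Num.max a (Num.min t b)).
Proof.
move=> t.
apply: (@continuous_max _ _ (cst a) (fun t : R => Num.min t b) t).
  exact: cst_continuous.
apply: (@continuous_min _ _ (fun t : R => t) (cst b) t).
  exact: cvg_id.
exact: cst_continuous.
Qed.

Lemma continuous_bounded_itv (q : R -> R) (a b : R) : a <= b -> continuous q ->
  exists K, forall v, a <= v <= b -> `|q v| <= K.
Proof.
move=> ab qC.
have [|c _ H] := @EVT_max _ (fun v => `|q v|) a b ab.
  by apply: continuous_subspaceT => v; apply: continuous_comp; [exact: qC|exact: norm_continuous].
by exists `|q c| => v; move=> vab; apply: H; rewrite in_itv.
Qed.

(** The factor [1 - x0 *+ 2] is 1 at the left end and -1 at the right end, so one argument serves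
    both. Times are restricted to the open set where [ch (rho t) > 0], because the weight has to
    absorb the inverse of this quantity. *)
Lemma trace_sign (J S q ch rho : R -> R) (u : R * R -> R) (x0 : R) :
  x0 = 0 \/ x0 = 1 -> Loo_dom u -> lax_pair J S q ->
  continuous ch -> (forall w, 0 <= ch w) ->
  (forall t, 0 < t -> {for t, continuous rho}) ->
  (forall phi, test_function phi -> (forall p, 0 <= phi p) ->
    0 <= \int[mu]_(t in `[0, +oo[)
           \int[mu]_(x in `[0, 1]) (q (u (t, x)) * partial2 phi (t, x))) ->
  (forall b, C0 b -> (forall t, 0 <= b t) -> forall e, 0 < e ->
    exists2 de, 0 < de & {ae mu, forall x, 0 < x < 1 -> `|x - x0| < de ->
      (1 - x0 *+ 2) * \int[mu]_(t in `[0, +oo[)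
         (q (u (t, x)) * ch (rho t) * b t) <= e}) ->
  {ae mu2, forall p : R * R, 0 < p.1 -> 0 < ch (rho p.1) -> 0 < p.2 < 1 ->
     (1 - x0 *+ 2) * q (u p) <= 0}.
Proof.
move=> x0P [mu_ [M uM]] [_ qC2 _ _] chC ch0 rhoC Hphi Hb.
set sg := 1 - x0 *+ 2 in Hb *.
have sg1 : `|sg| = 1.
  by rewrite /sg; case: x0P => ->; rewrite ?mul0rn ?subr0 ?normr1// mulr2n opprD addrA subrr sub0r normrN normr1.
have x001 : 0 <= x0 <= 1 by case: x0P => ->; rewrite ?lexx ?ler01.
have qC : continuous q by apply: (@Cn_continuous _ 2); exact: C2_Cn.
have mq : measurable_fun setT q by exact: continuous_measurable_fun.
have mdom : measurable (@dom R) by exact: measurableX.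
(* Extending [u] by zero and then clipping it to [[- N, N]] yields a function on the plane that is
   bounded everywhere, as the pairing lemmas demand, and equals [u] almost everywhere on [dom]. *)
pose u0 := u \_ dom.
have mu0 : measurable_fun setT u0 by apply/(measurable_restrictT _ _).1.
pose N := `|M|.
have NN : - N <= N by rewrite -subr_ge0 opprK addr_ge0 ?normr_ge0.
pose uc p := Num.max (- N) (Num.min (u0 p) N).
have muc : measurable_fun setT uc.
  by apply: measurable_maxr => //; exact: measurable_minr.
have u0c : {ae mu2, forall p, u0 p = uc p}.
  move: uM; apply: ae_impl => p up; rewrite /uc clip_id// -ler_norml /u0 patchE.
  case: ifPn => [|_]; last by rewrite normr0 normr_ge0.
  by rewrite inE => /up; move/le_trans; apply; exact: ler_norm.
have [K qK] : exists K, forall v, - N <= v <= N -> `|q v| <= K.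
  exact: continuous_bounded_itv.
pose D p := sg * q (uc p).
have mquc : measurable_fun setT (fun p => q (uc p)) by exact: measurableT_comp.
have mqu0 : measurable_fun setT (fun p => q (u0 p)) by exact: measurableT_comp.
have mD : measurable_fun setT D.
  by apply: measurable_funM => //; exact: measurable_cst.
have qucK p : `|q (uc p)| <= K by exact: qK (clip_itv _ NN).
have DK p : `|D p| <= K by rewrite normrM sg1 mul1r.
pose V := [set t : R | 0 < t /\ 0 < ch (rho t)].
have oV : open V.
  rewrite openE => t [t0 ct]; rewrite /interior /=.
  have h1 : \forall y \near t, 0 < y by exact: lt_nbhsr.
  have h2 : \forall y \near t, 0 < ch (rho y).
    have cc : {for t, continuous (ch \o rho)}.
      by apply: continuous_comp; [exact: rhoC|exact: chC].
    exact: (@cvgr_gt _ _ _ _ _ (ch (rho t)) cc 0 ct).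
  by near=> y; split; near: y.
have oW : open (`]0, 1[%classic : set R) by exact: itv_open.
suff : {ae mu2, forall p : R * R, V p.1 -> `]0, 1[%classic p.2 -> D p <= 0}.
  move=> HD; move: (ae_and HD u0c); apply: ae_impl => p [Dp up] p1 cp p2.
  have -> : u p = uc p.
    rewrite -up /u0 patchE mem_set//; split; rewrite /= in_itv/=.
      by rewrite andbT ltW.
    by case/andP: p2 => /ltW -> /ltW ->.
  by apply: Dp => //; rewrite /= in_itv.
apply: (bump_test2_ae_le0 mD DK oV oW) => a b c d n k ab cd abV cdW.
move: ab cd abV cdW.
move: (ratr a) (ratr b) (ratr c) (ratr d) (n.+1%:R : R) (k.+1%:R : R)
  (ler0n R n.+1) (ler0n R k.+1) => {}a {}b {}c {}d s r s0 r0 ab cd abV cdW.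
have [a0 _] : V a by apply: abV; rewrite /= in_itv/= lexx ltW.
have c0 : 0 < c.
  have : `]0, 1[%classic c by apply: cdW; rewrite /= in_itv/= lexx ltW.
  by rewrite /= in_itv/= => /andP[].
have d1 : d < 1.
  have : `]0, 1[%classic d by apply: cdW; rewrite /= in_itv/= lexx ltW.
  by rewrite /= in_itv/= => /andP[].
have al0 t : bump a b s t != 0 -> a <= t <= b.
  apply: contraNT => h; apply/eqP; apply: bump_out => //.
  by apply: contra h => /andP[/ltW -> /ltW ->].
have mal : measurable_fun setT (bump a b s) by exact: measurable_bump.
apply: (bump_pairing_le0_of_trace mD DK x001 s0 r0 c0 cd d1).
- move=> l l1; have l0 : 0 < l by rewrite (lt_le_trans ltr01).
  have [psi [c' [d' [psiC [c'0 d'1] psi0 psi_ge0 dpsi]]]] :=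
    collar_test x0P r0 c0 cd d1 l1.
  set c1 := x0 + (c - x0) / l in dpsi *; set d2 := x0 + (d - x0) / l in dpsi *.
  have cd1 : c1 <= d2 by rewrite lerD2l ler_pM2r ?invr_gt0// lerD2r ltW.
  pose kap x := sg * (l * bump c1 d2 (l * r) x - bump c d r x).
  pose phi (p : R * R) := bump a b s p.1 * (sg * psi p.2).
  have tphi : test_function phi.
    apply: (@test_function_prod _ _ (fun x => sg * psi x) a b c' d') => //.
    - by move=> j; exact: Cn_bump.
    - by move=> j; apply: CnM => //; exact: Cn_cst.
    - by move=> x; rewrite mulf_eq0 negb_or => /andP[_ /psi0].
  have phi_ge0 p : 0 <= phi p by rewrite mulr_ge0// bump_ge0.
  have dphi p : partial2 phi p = bump a b s p.1 * kap p.2.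
    have dkap (x : R) : is_derive x 1 (fun x => sg * psi x) (kap x).
      exact: (@is_deriveZ _ _ _ psi sg x 1 _ (dpsi x)).
    exact: (partial2_prod _ _ dkap).
  (* The entropy inequality integrates over the unit interval and the pairings over the whole line;
     the vanishing of [kap] outside reconciles them. *)
  have kap0 x : ~~ (0 <= x <= 1) -> kap x = 0.
    have sup e f z (z0 : 0 <= z) : 0 <= e -> f <= 1 -> ~~ (0 <= x <= 1) -> bump e f z x = 0.
      move=> e0 f1 h; apply: bump_out => //; apply: contra h => /andP[h1 h2].
      by rewrite (le_trans e0 (ltW h1)) (le_trans (ltW h2) f1).
    have lr0 : 0 <= l * r by exact: mulr_ge0 (ltW l0) r0.
    have lV0 : 0 <= l^-1 by rewrite invr_ge0 ltW.
    have lV1 : 0 <= 1 - l^-1 by rewrite subr_ge0 invf_le1.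
    have [x00 x01] := andP x001.
    have c1_ge0 : 0 <= c1.
      have -> : c1 = x0 * (1 - l^-1) + c * l^-1 by rewrite /c1; ring.
      by apply: addr_ge0; apply: mulr_ge0 => //; exact: ltW.
    have d2_le1 : d2 <= 1.
      rewrite -subr_ge0 (_ : 1 - d2 = (1 - x0) * (1 - l^-1) + (1 - d) * l^-1).
        by apply: addr_ge0; apply: mulr_ge0 => //; rewrite subr_ge0// ltW.
      by rewrite /d2; ring.
    move=> h; rewrite /kap (sup _ _ _ lr0 c1_ge0 d2_le1 h).
    by rewrite (sup _ _ _ r0 (ltW c0) (ltW d1) h) mulr0 subrr mulr0.
  have mkap : measurable_fun setT kap.
    apply: measurable_funM => //; apply: measurable_funB; last exact: measurable_bump.
    by apply: measurable_funM => //; exact: measurable_bump.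
  have := Hphi phi tphi phi_ge0.
  have malkap : measurable_fun setT (fun p : R * R => bump a b s p.1 * kap p.2).
    by apply: measurable_funM; apply: measurableT_comp.
  rewrite (@iterated_Rintegral_mkcond _ _ _ (fun t x => q (u (t, x)) * partial2 phi (t, x))).
  rewrite (_ : (_ \_ _) = (fun p => q (u0 p) * (bump a b s p.1 * kap p.2))); last first.
    apply/funext => p; rewrite /u0 !patchE /dom; case: ifPn => hp.
      by rewrite dphi; case: p hp.
    suff -> : bump a b s p.1 * kap p.2 = 0 by rewrite mulr0.
    move: hp; rewrite in_setX negb_and => /orP[hp|hp]; last first.
      by rewrite kap0 ?mulr0//; apply: contra hp => hp; rewrite inE/= in_itv.
    suff -> : bump a b s p.1 = 0 by rewrite mul0r.
    apply/eqP; apply: contraNT hp => /al0/andP[h _].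
    by rewrite inE/= in_itv/= andbT (le_trans _ h)// ltW.
  rewrite (@ae_eq_iterated_Rintegral _ (fun p => q (u0 p) * (bump a b s p.1 * kap p.2))
    (fun p => q (uc p) * (bump a b s p.1 * kap p.2))).
  + have lr0 : 0 <= l * r by exact: mulr_ge0 (ltW l0) r0.
    rewrite -subr_ge0 -(bump_pairing_sub a b l mD DK s0 r0 lr0 (ltW cd) cd1).
    move=> h; apply: le_trans h _; rewrite le_eqVlt; apply/orP; left; apply/eqP.
    apply: eq_Rintegral => t _; apply: eq_Rintegral => x _.
    by rewrite /D /kap; ring.
  + exact: measurable_funM.
  + exact: measurable_funM.
  + by move: u0c; apply: ae_impl => p ->.
- move=> e e0.
  (* Clipping the time inside the denominator keeps [ch (rho (cl t))] positive on the whole line, so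
     [be] is continuous; outside [[a, b]] the bump vanishes and the quotient is 0. *)
  pose cl t := Num.max a (Num.min t b).
  have clP t : V (cl t).
    by apply: abV; rewrite /= in_itv/=; apply: clip_itv; exact: ltW.
  pose be t := bump a b s t / ch (rho (cl t)).
  have beC : continuous be.
    move=> t; apply: cvgM; first exact: (@Cn_bump _ 0).
    apply: cvgV; first by rewrite gt_eqF//; case: (clP t).
    apply: (@continuous_comp _ _ _ (rho \o cl) ch); last exact: chC.
    apply: continuous_comp; first exact: clip_continuous.
    by apply: rhoC; case: (clP t).
  have beC0 : C0 be.
    split=> //; apply: (@subclosed_compact _ _ `[a, b]%classic).
    - exact: closed_closure.
    - exact: segment_compact.
    - rewrite /supp [X in _ `<=` X](closure_id _).1; last exact: itv_closed.
      apply: closure_subset => t /=; rewrite in_itv/= mulf_eq0 negb_or => /andP[h _].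
      exact: al0.
  have be0 t : 0 <= be t by rewrite divr_ge0// bump_ge0.
  have [de de0 H] := Hb be beC0 be0 e e0.
  exists de => //; move: (ae_and H (ae_sections2 u0c)).
  apply: ae_impl => x [Hx ux] x01 xde.
  apply: le_trans (Hx x01 xde); rewrite le_eqVlt; apply/orP; left; apply/eqP.
  have muc1 : measurable_fun setT (fun t => q (uc (t, x))).
    exact: (measurableT_comp mquc).
  have i := integrable_mul_bump a b s0 muc1 (fun t => qucK (t, x)).
  transitivity (sg * \int[mu]_t (q (uc (t, x)) * bump a b s t)).
    rewrite -(RintegralZl sg measurableT i).
    by apply: eq_Rintegral => t _; rewrite /D mulrA.
  congr (_ * _); rewrite [RHS]Rintegral_mkcond.
  transitivity (\int[mu]_t (q (u0 (t, x)) * bump a b s t)).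
    apply: ae_eq_Rintegral.
    - exact: (measurable_funM muc1 mal).
    - have mu01 : measurable_fun setT (fun t => q (u0 (t, x))).
        exact: (measurableT_comp mqu0).
      exact: (measurable_funM mu01 mal).
    - by move: ux; apply: ae_impl => t ->.
  apply: eq_Rintegral => t _; rewrite patchE /u0 patchE /dom in_setX.
  have -> : x \in `[0, 1]%classic.
    by rewrite inE/= in_itv/=; case/andP: x01 => /ltW -> /ltW ->.
  rewrite andbT; case: ifPn => ht; last first.
    suff -> : bump a b s t = 0 by rewrite mulr0.
    apply/eqP; apply: contraNT ht => /al0/andP[h _].
    by rewrite inE/= in_itv/= andbT (le_trans _ h)// ltW.
  rewrite -mulrA; congr (_ * _); rewrite /be.
  have [->|/al0 tab] := eqVneq (bump a b s t) 0; first by rewrite mul0r mulr0.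
  rewrite /cl clip_id// mulrCA divff ?mulr1// gt_eqF//.
  by have [] : V t by apply: abV; rewrite /= in_itv.
Unshelve. all: by end_near. Qed.

End trace_sign.

(** * Existence and uniqueness of the quasi-static solution *)

Section solution.
Context {R : realType}.
Notation mu := (@lebesgue_measure R).

Lemma ae_mu2_fst (P : R -> Prop) :
  {ae mu, forall t, P t} -> {ae mu2, forall p : R * R, P p.1}.
Proof.
case=> N [mN N0 PN].
apply: (@ae_mu2_of_sections _ _ (N `*` setT)).
- exact: measurableX.
- by move=> p nN; apply: contrapT => nP; apply: nN; split=> //; exact: PN.
- have : {ae mu, forall t, ~ N t} by exists N; split=> // t /=; exact: contrapT.
  by apply: ae_impl => t Nt; apply: aeW => x [].
Qed.

Lemma ae_mu2_snd (P : R -> Prop) :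
  {ae mu, forall x, P x} -> {ae mu2, forall p : R * R, P p.2}.
Proof.
case=> N [mN N0 PN].
apply: (@ae_mu2_of_sections _ _ (setT `*` N)).
- exact: measurableX.
- by move=> p nN; apply: contrapT => nP; apply: nN; split=> //; exact: PN.
- apply: aeW => t.
  have : {ae mu, forall x, ~ N x} by exists N; split=> // x /=; exact: contrapT.
  by apply: ae_impl => x Nx [].
Qed.

Lemma ae_neq (a : R) : {ae mu, forall x, x != a}.
Proof.
exists [set a]; split; [exact: measurable_set1|exact: lebesgue_measure_set1|].
by move=> x /= /negP; rewrite negbK => /eqP.
Qed.

Lemma ae_dom_interior :
  {ae mu2, forall p : R * R, dom p -> 0 < p.1 /\ 0 < p.2 < 1}.
Proof.
move: (ae_and (ae_mu2_fst (ae_neq 0)) (ae_and (ae_mu2_snd (ae_neq 0)) (ae_mu2_snd (ae_neq 1)))).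
apply: ae_impl => p [p1 [p2 p3]] [/=]; rewrite !in_itv/= andbT => h1 /andP[h2 h3].
by rewrite !lt_neqAle h1 h2 h3 !(eq_sym 0) p1 p2 p3.
Qed.

(** The positive part integrates to 0, and [fine] sends an infinite integral of the negative part to
    0, which is still nonpositive. *)
Lemma Rintegral_le0 (D : set R) (f : R -> R) :
  (forall x, D x -> f x <= 0) -> \int[mu]_(x in D) f x <= 0.
Proof.
move=> f0; rewrite /Rintegral integralE.
rewrite (@eq_integral _ _ _ mu D (cst 0%E)); last first.
  by move=> x /set_mem Dx; rewrite funeposE max_r// lee_fin f0.
by rewrite integral0 sub0e fineN oppr_le0 fine_ge0// integral_ge0.
Qed.

Section C1.
Variable rho : R -> R.
Hypothesis rhoC : C1_Rplus rho.

Let rho_near (t e : R) : 0 <= t -> 0 < e ->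
  \forall s \near t, 0 <= s -> `|rho t - rho s| < e.
Proof.
case: rhoC => d _ rhod t0 e0.
pose F := within `[0, +oo[%classic t^'.
have FF : Filter F by exact: within_filter.
have Ft : s @[s --> F] --> t.
  apply: cvg_trans (cvg_within _) _; exact: cvg_within.
have h : (rho s - rho t) / (s - t) * (s - t) @[s --> F] --> d t * (t - t).
  apply: cvgM; first exact: rhod.
  by apply: cvgB => //; exact: cvg_cst.
rewrite subrr mulr0 in h.
have /cvgrPdist_lt/(_ e e0) := h.
rewrite /F /within /= => H; move: H; rewrite near_withinE => H.
near=> s => s0.
have [->|st] := eqVneq s t; first by rewrite subrr normr0.
have : s != t -> `[0, +oo[%classic s -> `|0 - (rho s - rho t) / (s - t) * (s - t)| < e.
  by near: s.
move=> /(_ st); rewrite /= in_itv/= andbT => /(_ s0).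
by rewrite divfK ?subr_eq0// sub0r normrN distrC.
Unshelve. all: by end_near. Qed.

Lemma C1_Rplus_continuous (t : R) : 0 < t -> {for t, continuous rho}.
Proof.
move=> t0; apply/cvgrPdist_lt => e e0.
have h := rho_near (ltW t0) e0.
near=> s; have : 0 <= s -> `|rho t - rho s| < e by near: s.
by apply; apply: ltW; near: s; exact: lt_nbhsr.
Unshelve. all: by end_near. Qed.

Lemma C1_Rplus_max_continuous : continuous (fun t : R => rho (Num.max 0 t)).
Proof.
move=> t; apply/cvgrPdist_lt => e e0.
have t0 : 0 <= Num.max 0 t by rewrite le_max lexx.
have mC : (Num.max 0 s) @[s --> t] --> Num.max 0 t.
  apply: (@continuous_max _ _ (cst 0) (fun s : R => s) t).
    exact: cst_continuous.
  exact: cvg_id.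
have h := mC _ (rho_near t0 e0).
near=> s.
have : 0 <= Num.max 0 s -> `|rho (Num.max 0 t) - rho (Num.max 0 s)| < e.
  by near: s; exact: h.
by apply; rewrite le_max lexx.
Unshelve. all: by end_near. Qed.

End C1.

(** The support lies in the open strip, so [phi] vanishes at both ends and the fundamental theorem
    of calculus gives 0. This settles the interior conditions for any function of [t] alone. *)
Lemma integral_test_function (phi : R * R -> R) (t c : R) : test_function phi ->
  \int[mu]_(x in `[0, 1]) (c * partial2 phi (t, x)) = 0.
Proof.
move=> [phiC _ phiS].
have [phi0 [_ phid2 _ dphiC]] := phiC 1%N.
have {}dphiC : continuous (partial2 phi) by case: dphiC.
have sC : continuous (fun x => partial2 phi (t, x)).
  move=> x; apply: (@continuous_comp _ _ _ (fun x : R => (t, x)) (partial2 phi)).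
    by apply: (@cvg_pair _ _ _ _ (nbhs t) (nbhs x)); [exact: cvg_cst|exact: cvg_id].
  exact: dphiC.
have ds (x : R) : is_derive x 1 (fun y => phi (t, y)) (partial2 phi (t, x)).
  exact: (@is_derive_of_slice2 _ phi (t, x) (phid2 (t, x))).
have sw : {within `[0, 1], continuous (fun x => partial2 phi (t, x))}.
  exact: continuous_subspaceT.
have i : mu.-integrable `[0, 1] (EFin \o (fun x => partial2 phi (t, x))).
  by apply: continuous_compact_integrable => //; exact: segment_compact.
have phi_end x : x = 0 \/ x = 1 -> phi (t, x) = 0.
  move=> x01; apply/eqP/negP => /negP nz.
  have /phiS[/= _] : supp phi (t, x) by apply: subset_closure.
  by rewrite in_itv/=; case: x01 => ->; rewrite ltxx ?andbF.
have sc (x : R) : {for x, continuous (fun y => phi (t, y))}.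
  exact: is_derive_continuous (ds x).
rewrite RintegralZl//.
rewrite /Rintegral (@continuous_FTC2 _ (fun x => partial2 phi (t, x)) (fun x => phi (t, x)) 0 1)//.
- by rewrite (phi_end 1 (or_intror erefl)) (phi_end 0 (or_introl erefl)) subee//= mulr0.
- split=> [x _||].
  + by case: (ds x).
  + apply: cvg_at_right_filter; exact: sc.
  + apply: cvg_at_left_filter; exact: sc.
- by move=> x _; exact: is_derive_derive1.
Qed.

Section theorem.
Variables (J : R -> R) (m : R) (rhom rhop : R -> R).
Hypothesis J_C2 : C2 J.
Hypothesis J_concave : forall v, derive1 (derive1 J) v < 0.
Hypotheses (J0 : J 0 = 0) (J1 : J 1 = 0) (m01 : 0 < m < 1).
Hypothesis m_max : unique_max_point J m.
Hypotheses (rhom_C1 : C1_Rplus rhom) (rhop_C1 : C1_Rplus rhop).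
Hypothesis rhom01 : forall t, 0 <= t -> 0 <= rhom t <= 1.
Hypothesis rhop01 : forall t, 0 <= t -> 0 <= rhop t <= 1.

(** The data are arbitrary at negative times; freezing them at their value at 0 makes them
    continuous on the line, hence the solution measurable on the plane. *)
Definition quasistatic_solution (p : R * R) : R :=
  quasistatic J m (rhom (Num.max 0 p.1)) (rhop (Num.max 0 p.1)).

Lemma quasistatic_solutionE t x : 0 <= t ->
  quasistatic_solution (t, x) = quasistatic J m (rhom t) (rhop t).
Proof. by move=> t0; rewrite /quasistatic_solution max_r. Qed.

Lemma measurable_quasistatic_solution : measurable_fun setT quasistatic_solution.
Proof.
have mJ : measurable_fun setT J.
  by apply: continuous_measurable_fun; exact: flux_continuous.
have mm := continuous_measurable_fun (C1_Rplus_max_continuous rhom_C1).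
have mp := continuous_measurable_fun (C1_Rplus_max_continuous rhop_C1).
have ma : measurable_fun setT (fun t : R => Num.min (rhom (Num.max 0 t)) m).
  by apply: measurable_minr => //; exact: measurable_cst.
have mb : measurable_fun setT (fun t : R => Num.max (rhop (Num.max 0 t)) m).
  by apply: measurable_maxr => //; exact: measurable_cst.
apply: (@measurableT_comp _ _ _ _ _ _
  (fun t : R => quasistatic J m (rhom (Num.max 0 t)) (rhop (Num.max 0 t))) _ fst) => //.
apply: measurable_fun_ifT => //.
by apply: measurable_fun_ltr; exact: measurableT_comp.
Qed.

(** Because the solution does not depend on [x], the boundary integrals are constant in [r] and are
    their own essential limits; their signs come from [quasistatic_left] and [quasistatic_right]. *)
Lemma quasistatic_solution_entropy :
  entropy_solution J rhom rhop quasistatic_solution.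
Proof.
have [m0 m1] := andP m01.
have phi0 (f : R -> R) phi : test_function phi ->
    \int[mu]_(t in `[0, +oo[) \int[mu]_(x in `[0, 1])
      (f (quasistatic_solution (t, x)) * partial2 phi (t, x)) = 0.
  move=> tphi; rewrite (@eq_Rintegral _ _ _ _ _ (cst 0)) ?Rintegral_cst ?mul0r// => t _.
  exact: (integral_test_function t (f (quasistatic_solution (t, 0))) tphi).
have lim_cst (g : R -> R) (l : R) : (forall r, g r = l) -> esslim0 g l.
  by move=> gl e e0; exists 1 => //; apply: aeW => r _; rewrite gl subrr normr0.
split.
- split; first exact: measurable_funTS measurable_quasistatic_solution.
  exists 1; apply: aeW => p _; rewrite /quasistatic_solution.
  have t0 : 0 <= Num.max 0 p.1 by rewrite le_max lexx.
  have [a0 a1] := andP (rhom01 t0); have [b0 b1] := andP (rhop01 t0).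
  rewrite /quasistatic; case: ifPn => _; rewrite ger0_norm.
  + by rewrite ge_max b1 ltW.
  + by rewrite le_max b0.
  + by rewrite ge_min a1.
  + by rewrite le_min a0 ltW.
- by move=> phi; exact: phi0.
- by move=> S Q phi _ tphi _; rewrite phi0.
- move=> Q b [S SQ] bC0 b0; split.
  + exists (\int[mu]_(t in `[0, +oo[) (Q (quasistatic_solution (t, 0), rhom t) * b t)).
      apply: Rintegral_le0 => t; rewrite /= in_itv/= andbT => t0.
      rewrite mulr_le0_ge0// quasistatic_solutionE//.
      exact: (quasistatic_left J_C2 J_concave m_max _ _ SQ).
    by apply: lim_cst => r; apply: eq_Rintegral => t _.
  + exists (\int[mu]_(t in `[0, +oo[) (Q (quasistatic_solution (t, 0), rhop t) * b t)).
      apply: Rintegral_ge0 => t; rewrite /= in_itv/= andbT => t0.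
      rewrite mulr_ge0// quasistatic_solutionE//.
      exact: (quasistatic_right J_C2 J_concave m_max _ _ SQ).
    by apply: lim_cst => r; apply: eq_Rintegral => t _.
Qed.

Lemma half_flux_family : exists q : rat -> rat -> R -> R,
  forall k k' : rat, k != k' -> half_flux J (ratr k) (ratr k') (q k k').
Proof.
have H (kk : rat * rat) : exists q : R -> R,
    kk.1 != kk.2 -> half_flux J (ratr kk.1) (ratr kk.2) q.
  have [h|h] := eqVneq kk.1 kk.2; first by exists (cst 0).
  have rne : ratr kk.1 != ratr kk.2 :> R by rewrite (inj_eq (fmorph_inj _)).
  by have [q qP] := half_flux_exists J_C2 rne; exists q.
have [q qP] := choice H.
by exists (fun k k' => q (k, k')) => k k' kk'; exact: (qP (k, k')).
Qed.

Let chi_continuous (k k' : R) : continuous (@chi R k k').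
Proof.
rewrite (_ : chi k k' = (fun w => invexp 0 (- (k' - k)^-1 * w + k / (k' - k)))).
  exact: (@Cn_affine _ 0 _ _ _ (Cn_invexp 0 0)).
by apply/funext => w; rewrite /chi mulrBl mulNr addrC [w / _]mulrC.
Qed.

(** Pairs of rationals being countable, one null set serves all thresholds. Off it, the bounds
    coming from both ends hold pointwise, and [quasistatic_unique] concludes from the three numbers
    [v p], [rhom p.1] and [rhop p.1]. *)
Lemma entropy_solution_unique v : entropy_solution J rhom rhop v ->
  {ae mu2, forall p : R * R, dom p ->
    ~ Theta J m (rhom p.1, rhop p.1) -> v p = quasistatic_solution p}.
Proof.
move=> [vLoo _ ventr vbdry].
have [q qP] := half_flux_family.
have left_sign : {ae mu2, forall p : R * R, forall kk : rat * rat, kk.1 != kk.2 ->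
    0 < p.1 -> 0 < p.2 < 1 -> 0 < chi (ratr kk.1) (ratr kk.2) (rhom p.1) ->
    q kk.1 kk.2 (v p) <= 0}.
  apply: ae_forall_countable => -[k k'] /=.
  have [kk'|kk'] := eqVneq k k'; first by apply: aeW.
  have [[S SQ] bf _] := qP _ _ kk'.
  have chC : continuous (chi (ratr k) (ratr k') : R -> R) by exact: chi_continuous.
  have ch0 (w : R) : 0 <= chi (ratr k) (ratr k') w by exact: invexp_ge0.
  have H := @trace_sign _ J S (q k k') _ rhom v 0 (or_introl erefl) vLoo SQ chC ch0
    (C1_Rplus_continuous rhom_C1) (fun phi => @ventr S _ phi SQ).
  suff : {ae mu2, forall p : R * R, 0 < p.1 ->
      0 < chi (ratr k) (ratr k') (rhom p.1) -> 0 < p.2 < 1 ->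
      (1 - 0 *+ 2) * q k k' (v p) <= 0}.
    apply: ae_impl => p Hp _ p1 p2 cp.
    by have := Hp p1 cp p2; rewrite mul0rn subr0 mul1r.
  apply: H => b bC0 b0 e e0.
  have [[l l0 /(_ e e0)[de de0 Hde]] _] := vbdry _ b bf bC0 b0.
  exists de => //; move: Hde; apply: ae_impl => x Hx /andP[x0 x1].
  rewrite subr0 gtr0_norm// mul0rn subr0 mul1r => xde.
  have : `|\int[mu]_(t in `[0, +oo[)
     (q k k' (v (t, x)) * chi (ratr k) (ratr k') (rhom t) * b t) - l| < e.
    by apply: Hx; rewrite x0.
  rewrite ltr_norml => /andP[_]; rewrite ltrBlDr => /ltW/le_trans; apply.
  by rewrite gerDl.
have right_sign : {ae mu2, forall p : R * R, forall kk : rat * rat, kk.1 != kk.2 ->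
    0 < p.1 -> 0 < p.2 < 1 -> 0 < chi (ratr kk.1) (ratr kk.2) (rhop p.1) ->
    0 <= q kk.1 kk.2 (v p)}.
  apply: ae_forall_countable => -[k k'] /=.
  have [kk'|kk'] := eqVneq k k'; first by apply: aeW.
  have [[S SQ] bf _] := qP _ _ kk'.
  have chC : continuous (chi (ratr k) (ratr k') : R -> R) by exact: chi_continuous.
  have ch0 (w : R) : 0 <= chi (ratr k) (ratr k') w by exact: invexp_ge0.
  have H := @trace_sign _ J S (q k k') _ rhop v 1 (or_intror erefl) vLoo SQ chC ch0
    (C1_Rplus_continuous rhop_C1) (fun phi => @ventr S _ phi SQ).
  have sgE : 1 - 1 *+ 2 = -1 :> R by rewrite mulr2n; ring.
  rewrite sgE in H.
  suff : {ae mu2, forall p : R * R, 0 < p.1 ->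
      0 < chi (ratr k) (ratr k') (rhop p.1) -> 0 < p.2 < 1 ->
      (-1) * q k k' (v p) <= 0}.
    apply: ae_impl => p Hp _ p1 p2 cp.
    by have := Hp p1 cp p2; rewrite mulN1r oppr_le0.
  apply: H => b bC0 b0 e e0.
  have [_ [l l0 /(_ e e0)[de de0 Hde]]] := vbdry _ b bf bC0 b0.
  (* The condition at the right end is phrased in the distance [r = 1 - x]; reflection turns it into
     a statement about [x] near 1. *)
  exists de => //; move: (ae_onem Hde); apply: ae_impl => x.
  rewrite subKr => Hx /andP[x0 x1].
  rewrite distrC gtr0_norm ?subr_gt0// => xde.
  have : `|\int[mu]_(t in `[0, +oo[)
     (q k k' (v (t, x)) * chi (ratr k) (ratr k') (rhop t) * b t) - l| < e.
    by apply: Hx; rewrite subr_gt0 x1.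
  by rewrite ltr_norml => /andP[h _]; rewrite mulN1r; move: h l0; lra.
move: (ae_and left_sign (ae_and right_sign ae_dom_interior)).
apply: ae_impl => -[t x] [Hl [Hr Hi]] dp nT.
have [/= t0 x01] := Hi dp.
rewrite quasistatic_solutionE ?ltW//.
have [l1 l2] := half_flux_left_bounds J_C2 J_concave m_max qP
  (fun k k' (kk' : k != k') => Hl (k, k') kk' t0 x01).
have [r1 r2] := half_flux_right_bounds J_C2 J_concave m_max qP
  (fun k k' (kk' : k != k') => Hr (k, k') kk' t0 x01).
apply: (quasistatic_unique J_C2 J_concave m_max) => // -[am mb Jab].
apply: nT; apply: (Theta_of_eq J_C2 J_concave m_max J0 J1 m01) => //.
- exact: rhom01 (ltW t0).
- exact: rhop01 (ltW t0).
Qed.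

End theorem.
End solution.

Theorem proposition3p2 (R : realType) (J : R -> R) (m : R)
    (rhom rhop : R -> R)
    (J_C2 : C2 J) (J_concave : forall v, derive1 (derive1 J) v < 0)
    (J0 : J 0 = 0) (J1 : J 1 = 0)
    (m01 : 0 < m < 1) (m_max : unique_max_point J m)
    (rhom_C1 : C1_Rplus rhom) (rhop_C1 : C1_Rplus rhop)
    (rhom01 : forall t, 0 <= t -> 0 <= rhom t <= 1)
    (rhop01 : forall t, 0 <= t -> 0 <= rhop t <= 1)
    (notTheta : {ae lebesgue_measure,
       forall t, 0 <= t -> ~ Theta J m (rhom t, rhop t)}) :
  exists u : R * R -> R,
    [/\ entropy_solution J rhom rhop u,
        forall v : R * R -> R, entropy_solution J rhom rhop v ->
          {ae mu2, forall p, dom p -> v p = u p}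
      & {ae mu2, forall p, dom p ->
          quasistatic_value J m (rhom p.1) (rhop p.1) (u p)}].

Proof.
have nT : {ae mu2, forall p : R * R, dom p ->
    ~ Theta J m (rhom p.1, rhop p.1)}.
  move: (ae_mu2_fst notTheta); apply: ae_impl => p H [/= t0 _]; apply: H.
  by move: t0; rewrite in_itv/= andbT.
exists (quasistatic_solution J m rhom rhop); split.
- exact: quasistatic_solution_entropy.
- move=> v hv.
  have := entropy_solution_unique J_C2 J_concave J0 J1 m01 m_max rhom_C1 rhop_C1
    rhom01 rhop01 hv.
  move=> /ae_and/(_ nT); apply: ae_impl => p [H1 H2] dp.
  by apply: H1 => //; exact: H2.
- move: nT; apply: ae_impl => -[t x] H dp.
  have t0 : 0 <= t by case: dp => /=; rewrite in_itv/= andbT.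
  rewrite quasistatic_solutionE//.
  apply: (quasistaticP J_C2 J_concave m_max J0 J1 m01).
  + exact: rhom01.
  + exact: rhop01.
  + exact: H.
Qed.
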